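(* Given a complete graph $K_n$ on $n$ vertices and any $t_m, t_c \in \mathbb{Z}^+$, the algorithm OptComplete (which arbitrarily embeds $T^*_n$ into $K_n$ and returns the greedy aggregation schedule on the embedded $T^*_n$) optimally solves the Token Computation problem on the Token Network $(K_n, t_c, t_m)$, i.e. it outputs a valid schedule of minimum possible length, and it runs in polynomial time.
   Context: Token Network model: an undirected graph $G=(V,E)$, $|V|=n$, with parameters $t_c, t_m \in \mathbb{N}$ (assumed $\mathrm{poly}(n)$; the smaller of $t_c,t_m$ divides the larger). Time proceeds in synchronous rounds. Every node starts with one atomic token. A node that is not busy and has at least one token may communicate: it is busy for the next $t_m$ rounds, after which one of its tokens is passed to a neighbor in $G$. A node that is not busy and has at least two tokens may compute: it is busy for the next $t_c$ rounds, after which two of its tokens are combined into a single new token. Nodes may receive tokens from several neighbors in the same round. The Token Computation problem: output a schedule directing each node when to compute and when/with whom to communicate such that, after running it, exactly one token remains in the whole network; the length of a schedule is its number of rounds. Define the rooted tree $T(R)=T(R,t_c,t_m)$ recursively: $T(R)$ is a single leaf if $R < t_m + t_c$, and otherwise $T(R) = T(R-t_c) \textsc{ join } T(R-t_c-t_m)$, where $T_1 \textsc{ join } T_2$ denotes $T_1$ with its root additionally given $T_2$ as a subtree. Let $R^*(n) = \min\{R : |T(R)| \ge n\}$ and $T^*_n = T(R^*(n))$ (assume $|T^*_n| = n$, otherwise extra nodes are hallucinated). Greedy aggregation on an $r$-rooted tree: in the first round every node except $r$ sends its token to its parent; in subsequent rounds, a non-busy node with at least two tokens computes, and a non-busy non-root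 node with exactly one token that has already received a token from every child forwards its token to its parent.
   Formalization: In greedy aggregation, only the leaves other than r (not every node except r) send in the first round; with the literal rule the claim fails, e.g. for t_c = t_m = 1, n = 5, where it takes 5 rounds while 4 suffice. *)

(* Defs.v *)
From mathcomp Require Import all_boot zify.

Set Implicit Arguments.
Unset Strict Implicit.
Unset Printing Implicit Defensive.

Record graph := Graph {
  vertex :> finType;
  edge : rel vertex;
  edge_sym : symmetric edge;
  edge_irrefl : irreflexive edge }.

Definition complete_graph (n : nat) : graph :=
  @Graph 'I_n (fun u v => u != v)
    (fun u v => congr1 negb (eq_sym u v)) (fun u => negbF (eqxx u)).

Inductive action (V : Type) := Idle | Compute | Send of V.
Arguments Idle {V}.
Arguments Compute {V}.

Definition is_idle V (a : action V) := if a is Idle then true else false.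
Definition sends_to (V : eqType) (a : action V) (v : V) :=
  if a is Send w then w == v else false.

Section TokenNetwork.
Variables (G : graph) (tc tm : nat).

(* Entry t of a schedule tells every node which operation to start at the
   beginning of round t; a busy node, and one that stays inactive, is told
   [Idle]. *)
Definition schedule := seq (G -> action G).

(* Tokens are anonymous, only their number at each node matters.  [left v] is
   the number of rounds for which [v] is still busy with the operation [cur v]
   ([cur v] is meaningless when [left v = 0]), and [got v u] records that [v]
   has already received a token from [u]. *)
Record config := Config {
  tok : G -> nat;
  cur : G -> action G;
  left : G -> nat;
  got : G -> G -> bool }.

Definition init : config :=
  Config (fun _ => 1) (fun _ => Idle) (fun _ => 0) (fun _ _ => false).

Definition busy (c : config) (v : G) := 0 < left c v.

Definition legal (c : config) (a : G -> action G) : bool :=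
  [forall v, match a v with
             | Idle => true
             | Compute => ~~ busy c v && (2 <= tok c v)
             | Send u => [&& ~~ busy c v, 1 <= tok c v & edge v u]
             end].

Definition duration (a : action G) :=
  match a with Idle => 0 | Compute => tc | Send _ => tm end.

(* One round.  An operation of duration d started in round t occupies rounds
   t, ..., t + d - 1 and takes effect at the end of the last one. *)
Definition step (c : config) (a : G -> action G) : config :=
  let cur' v := if is_idle (a v) then cur c v else a v in
  let left' v := if is_idle (a v) then left c v else duration (a v) in
  let fin v := if left' v == 1 then cur' v else Idle in
  Config
    (fun v => tok c v - ~~ is_idle (fin v) + #|[set u | sends_to (fin u) v]|)
    cur'
    (fun v => (left' v).-1)
    (fun v u => got c v u || sends_to (fin u) v).

Definition total (c : config) := \sum_v tok c v.

Fixpoint run (c : config) (S : schedule) : config :=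
  if S is a :: S' then run (step c a) S' else c.

Fixpoint legal_schedule (c : config) (S : schedule) : bool :=
  if S is a :: S' then legal c a && legal_schedule (step c a) S' else true.

Definition solves (S : schedule) : Prop :=
  legal_schedule init S /\ total (run init S) = 1.

Definition optimally_solves (S : schedule) : Prop :=
  solves S /\ forall S' : schedule, solves S' -> size S <= size S'.

(* [par] describes a rooted tree on the nodes; [par r = None] for the root.
   Before the first round every node holds exactly one token and has received
   none, so in that round the rule makes precisely the non-root leaves send. *)
Definition greedy_action (par : G -> option G) (c : config) (v : G) : action G :=
  if busy c v then Idle
  else if 2 <= tok c v then Compute
  else if (tok c v == 1) && [forall u, (par u == Some v) ==> got c v u] then
    (if par v is Some p then Send p else Idle)
  else Idle.

Fixpoint greedy_from (par : G -> option G) (fuel : nat) (c : config) : schedule :=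
  if fuel is k.+1 then
    if total c == 1 then [::]
    else greedy_action par c ::
         greedy_from par k (step c (greedy_action par c))
  else [::].

(* On a spanning tree greedy aggregation starts at most #|G| - 1 sends and
   #|G| - 1 computations and some node is busy in every round until one token
   is left, so the fuel is never exhausted. *)
Definition greedy_aggregation (par : G -> option G) : schedule :=
  greedy_from par (#|G| * (tc + tm)) init.

End TokenNetwork.

Inductive tree := Node of seq tree.

Definition leaf := Node [::].
Definition join (t1 t2 : tree) := let: Node ts := t1 in Node (rcons ts t2).

Fixpoint tree_size (t : tree) : nat :=
  let: Node ts := t in (sumn (map tree_size ts)).+1.

Fixpoint treeT_fuel (tc tm fuel R : nat) : tree :=
  if fuel is k.+1 then
    if R < tm + tc then leaf
    else join (treeT_fuel tc tm k (R - tc)) (treeT_fuel tc tm k (R - tc - tm))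
  else leaf.

Definition treeT (tc tm R : nat) : tree := treeT_fuel tc tm R R.

(* Each further tc + tm rounds add a node to T(R), which bounds the search;
   see [RstarP]. *)
Definition Rstar (tc tm n : nat) : nat :=
  find (fun R => n <= tree_size (treeT tc tm R)) (iota 0 (n * (tc + tm)).+1).

Definition Tstar (tc tm n : nat) : tree := treeT tc tm (Rstar tc tm n).

(* A node of a rooted tree is named by the path of child indices leading to it
   from the root [::], so that p is the parent of rcons p i. *)
Fixpoint is_node (t : tree) (p : seq nat) : bool :=
  if p is i :: q then
    let: Node ts := t in (i < size ts) && is_node (nth leaf ts i) q
  else true.

(* [f v] is the node of [t] placed at vertex [v] of K_n.  If [t] has n nodes
   this is a bijection; if it has more, the nodes missed by [f] are the
   hallucinated ones, and since they can neither compute nor forward no real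
   node may lie below one of them. *)
Definition embedding (t : tree) (n : nat) (f : 'I_n -> seq nat) : Prop :=
  [/\ injective f,
      forall v, is_node t (f v)
    & forall v p i, f v = rcons p i -> exists u, f u = p].

Definition embedded_parent (n : nat) (f : 'I_n -> seq nat) (v : 'I_n) :
    option 'I_n :=
  [pick u | f v == rcons (f u) (last 0 (f v))].

(* OptComplete, once the arbitrary embedding [f] of T*_n has been chosen. *)
Definition opt_complete (tc tm n : nat) (f : 'I_n -> seq nat) :
    schedule (complete_graph n) :=
  @greedy_aggregation (complete_graph n) tc tm (embedded_parent f).

(* Running time is measured on a while language over finitely many
   nat-indexed arrays of natural numbers, at unit cost per elementary
   operation.  Addition and subtraction are the only arithmetic, so within t
   steps numbers have O(t) bits and polynomial time is the usual notion. *)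
Inductive expr :=
  | Lit of nat
  | Get of nat & expr
  | Add of expr & expr
  | Sub of expr & expr.

Inductive com :=
  | Put of nat & expr & expr
  | Emit of expr
  | Seq of com & com
  | If of expr & com & com
  | While of expr & com.

Definition memory := nat -> nat -> nat.

Fixpoint eval (m : memory) (e : expr) : nat :=
  match e with
  | Lit k => k
  | Get x i => m x (eval m i)
  | Add e1 e2 => eval m e1 + eval m e2
  | Sub e1 e2 => eval m e1 - eval m e2
  end.

Fixpoint ecost (e : expr) : nat :=
  match e with
  | Lit _ => 1
  | Get _ i => (ecost i).+1
  | Add e1 e2 | Sub e1 e2 => (ecost e1 + ecost e2).+1
  end.

Definition update (m : memory) (x i k : nat) : memory :=
  fun y j => if (y == x) && (j == i) then k else m y j.

(* [exec c m o t m' o']: from memory [m] and output [o], command [c] halts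
   after [t] steps with memory [m'] and output [o']. *)
Inductive exec : com -> memory -> seq nat -> nat -> memory -> seq nat -> Prop :=
  | ExecPut x i e m o :
      exec (Put x i e) m o (ecost i + ecost e).+1
           (update m x (eval m i) (eval m e)) o
  | ExecEmit e m o :
      exec (Emit e) m o (ecost e).+1 m (rcons o (eval m e))
  | ExecSeq c1 c2 m o t1 m1 o1 t2 m2 o2 :
      exec c1 m o t1 m1 o1 -> exec c2 m1 o1 t2 m2 o2 ->
      exec (Seq c1 c2) m o (t1 + t2).+1 m2 o2
  | ExecIfTrue e c1 c2 m o t m' o' :
      eval m e != 0 -> exec c1 m o t m' o' ->
      exec (If e c1 c2) m o (ecost e + t).+1 m' o'
  | ExecIfFalse e c1 c2 m o t m' o' :
      eval m e = 0 -> exec c2 m o t m' o' ->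
      exec (If e c1 c2) m o (ecost e + t).+1 m' o'
  | ExecWhileTrue e c m o t1 m1 o1 t2 m2 o2 :
      eval m e != 0 -> exec c m o t1 m1 o1 -> exec (While e c) m1 o1 t2 m2 o2 ->
      exec (While e c) m o (ecost e + t1 + t2).+1 m2 o2
  | ExecWhileFalse e c m o :
      eval m e = 0 -> exec (While e c) m o (ecost e).+1 m o.

Definition input (n tc tm : nat) : memory :=
  fun x i => if i == 0 then nth 0 [:: n; tc; tm] x else 0.

Definition action_code (n : nat) (a : action 'I_n) : nat :=
  match a with Idle => 0 | Compute => 1 | Send u => (u : nat).+2 end.

(* Round by round, and inside a round vertex by vertex. *)
Definition schedule_code (n : nat) (S : schedule (complete_graph n)) : seq nat :=
  flatten [seq [seq action_code (a v) | v <- enum 'I_n] | a <- S].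

Lemma treeT_fuelS tc tm k R : 0 < tc -> R <= k ->
  treeT_fuel tc tm k R = treeT tc tm R.
Proof.
move=> tc0; rewrite /treeT.
suff H a b S : S <= a -> S <= b -> treeT_fuel tc tm a S = treeT_fuel tc tm b S.
  by move=> le_Rk; apply: H.
elim: a b S => [|a IH] [|b] S //=.
- by case: S => // _ _; rewrite addn_gt0 tc0 orbT.
- by case: S => // _ _; rewrite addn_gt0 tc0 orbT.
move=> Sa Sb; case: ltnP => // le_S.
by congr join; apply: IH; lia.
Qed.

Lemma treeT_rec tc tm R : 0 < tc ->
  treeT tc tm R =
  if R < tm + tc then leaf
  else join (treeT tc tm (R - tc)) (treeT tc tm (R - tc - tm)).
Proof.
move=> tc0; rewrite {1}/treeT; case: R => [|R] /=.
  by rewrite addn_gt0 tc0 orbT.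
by case: ltnP => // le_R; rewrite !treeT_fuelS //; lia.
Qed.

Lemma tree_size_gt0 t : 0 < tree_size t.
Proof. by case: t. Qed.

Lemma tree_size_join t1 t2 : tree_size (join t1 t2) = tree_size t1 + tree_size t2.
Proof.
case: t1 => ts /=; rewrite map_rcons -cats1 sumn_cat /=.
by rewrite addn0 addSn.
Qed.

Lemma treeT_size_ge tc tm n : 0 < tc -> n < tree_size (treeT tc tm (n * (tc + tm))).
Proof.
move=> tc0.
suff H m j R : m * (tc + tm) + j = R -> m < tree_size (treeT tc tm R).
  by apply: (H n 0); rewrite addn0.
elim: m j R => [|m IH] j R eR; first exact: tree_size_gt0.
have nR : (R < tm + tc) = false by apply/negbTE; rewrite -leqNgt; lia.
rewrite treeT_rec // nR tree_size_join.
have := IH (tm + j) (R - tc); have := tree_size_gt0 (treeT tc tm (R - tc - tm)).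
by lia.
Qed.

Lemma RstarP tc tm n : 0 < tc ->
  n <= tree_size (Tstar tc tm n) /\
  forall R, n <= tree_size (treeT tc tm R) -> Rstar tc tm n <= R.
Proof.
move=> tc0; set p := fun R => n <= tree_size (treeT tc tm R).
set B := (n * (tc + tm)).+1.
have hp : has p (iota 0 B).
  apply/hasP; exists (n * (tc + tm)); first by rewrite mem_iota add0n ltnS leqnn.
  exact: ltnW (treeT_size_ge tm n tc0).
have ltB : Rstar tc tm n < B by rewrite -[B](size_iota 0) -has_find.
split.
  by have := nth_find 0 hp; rewrite nth_iota.
move=> R pR; rewrite leqNgt; apply/negP => lt_R.
have := before_find 0 lt_R; rewrite nth_iota; last exact: ltn_trans lt_R ltB.
by rewrite add0n => /negP; apply.
Qed.

(* Main.v *)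
From mathcomp Require Import all_boot zify.
Require Import Defs.

(* Lower bound: let every token carry the number of initial tokens merged into
   it.  After t rounds, j tokens lying at one node weigh together at most
   |T(t + (j - 1) tc)|, since merging them there would take (j - 1) tc more
   rounds; an arrival adds a weight of at most |T(t - tm)|, which is the
   recursion defining T.  So the single final token needs R*(n) rounds.

   Upper bound: the node carrying the subtree T(R') has merged everything it
   receives within R' rounds, because its j-th child from the last one has
   budget R' - j tc - tm, hence delivers with j tc rounds to spare.  Dropping
   nodes of the tree only makes the greedy schedule faster.

   Running time: T*_n is grown by giving, n - 1 times, a child to the node whose
   next child has the largest budget, and the greedy schedule is then simulated
   round by round. *)

Set Implicit Arguments.
Unset Strict Implicit.
Unset Printing Implicit Defensive.

(** * Greedy aggregation meets its deadlines *)

Section Rounds.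
Variables (G : graph) (tc tm : nat).
Implicit Types (c : config G) (a : G -> action G) (u v : G).

(** Restates the local [fin] of [step], so that the equations below hold by conversion. *)
Definition finished c a v : action G :=
  if (if is_idle (a v) then left c v else duration tc tm (a v)) == 1
  then (if is_idle (a v) then cur c v else a v) else Idle.

Lemma tok_step c a v :
  tok (step tc tm c a) v =
  tok c v - ~~ is_idle (finished c a v)
  + #|[set u | sends_to (finished c a u) v]|.
Proof. by []. Qed.

Lemma got_step c a v u :
  got (step tc tm c a) v u = got c v u || sends_to (finished c a u) v.
Proof. by []. Qed.

Lemma cur_step c a v :
  cur (step tc tm c a) v = if is_idle (a v) then cur c v else a v.
Proof. by []. Qed.

Lemma left_step c a v :
  left (step tc tm c a) v =
  (if is_idle (a v) then left c v else duration tc tm (a v)).-1.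
Proof. by []. Qed.

Lemma sends_toP (x : action G) v : reflect (x = Send v) (sends_to x v).
Proof.
by case: x => [||w] /=; apply: (iffP idP) => // [/eqP->|[->]].
Qed.

End Rounds.

Arguments sends_toP {G x v}.

(** The values of [J] on [A] are distinct and lie between 1 and their maximum, so there are at most
    that many. *)
Lemma card_le_max_inj (T : finType) (J : T -> nat) (A : {set T}) :
  {in A &, injective J} -> (forall u, u \in A -> 0 < J u) -> A != set0 ->
  exists2 u, u \in A & #|A| <= J u.
Proof.
move=> injJ J0 /set0Pn[x xA].
case: (arg_maxnP J xA) => u uA maxu; exists u => //.
rewrite cardE -(size_map J).
rewrite -(size_iota 1 (J u)); apply: uniq_leq_size.
  rewrite map_inj_in_uniq ?enum_uniq // => y z.
  by rewrite !mem_enum; apply: injJ.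
move=> i /mapP[y]; rewrite mem_enum mem_iota => yA ->.
by have := J0 y yA; have := maxu y yA; lia.
Qed.

Section Greedy.
Variables (G : graph) (tc tm : nat) (par : G -> option G) (D J : G -> nat) (r : G).
Hypotheses (tc0 : 0 < tc) (tm0 : 0 < tm).
Hypothesis par_edge : forall u v, par u = Some v -> edge u v.
Hypothesis par_root : forall v, par v = None <-> v = r.
Hypothesis J_gt0 : forall u v, par u = Some v -> 0 < J u.
Hypothesis J_inj : forall u u' v,
  par u = Some v -> par u' = Some v -> J u = J u' -> u = u'.
(** In T*_n, [D u] is the budget of the subtree at [u], and [J u] is the rank of [u] among its
    siblings counted from the last. Sending at time [D u] then leaves the parent [J u] computations
    before its own deadline. *)
Hypothesis deadline : forall u v, par u = Some v -> D u + tm + J u * tc <= D v.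
Implicit Types (c : config G) (t : nat) (u v : G).

Let finish c u := finished tc tm c (greedy_action par c) u.
Let next c := step tc tm c (greedy_action par c).

Definition pending c v := [set u | (par u == Some v) && ~~ got c v u].
Definition delivered c v := if par v is Some p then got c p v else false.

(* [t] is the number of rounds already run, [D v] the round by which [v] must
   have merged everything it will ever receive. *)
Variant node_inv t c v : Prop :=
| Delivered of delivered c v & tok c v = 0 & left c v = 0 & pending c v = set0
| Waiting of ~~ delivered c v & 0 < tok c v & left c v = 0
    & t + ((tok c v).-1 + #|pending c v|) * tc <= D v
| Computing of ~~ delivered c v & cur c v = Compute & 1 < tok c v & 0 < left c v
    & t + left c v + ((tok c v).-2 + #|pending c v|) * tc <= D v
| Sending p of ~~ delivered c v & par v = Some p & cur c v = Send p
    & tok c v = 1 & 0 < left c v & pending c v = set0 & t + left c v <= D v + tm.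

Definition greedy_inv t c := forall v, node_inv t c v.

Lemma pending_max c v : pending c v != set0 ->
  exists u, [/\ par u = Some v, ~~ got c v u & #|pending c v| <= J u].
Proof.
move=> ne; have [||u] := @card_le_max_inj _ J (pending c v) _ _ ne.
- move=> x y; rewrite !inE => /andP[/eqP px _] /andP[/eqP py _].
  exact: J_inj px py.
- by move=> u; rewrite inE => /andP[/eqP /J_gt0].
by rewrite inE => /andP[/eqP pu gu] le; exists u.
Qed.

(** A waiting or computing node has [t <= D u] and its send still takes [tm > 0] rounds; a sending
    one is busy for at least one more round. Strictness pays for the round that a waiting node
    spends idle. *)
Lemma undelivered_early t c u : node_inv t c u -> ~~ delivered c u -> t < D u + tm.
Proof.
case=> [-> |_ _ _ bnd|_ _ _ _ bnd|p _ _ _ _ l0 _ bnd] // _.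
- by move: (_ * tc) bnd; lia.
- by move: (_ * tc) bnd; lia.
- by lia.
Qed.

(* The pending child with the largest rank is still on its way, so there is
   time left to process all pending children after its arrival. *)
Lemma slack_of_pending t c v : greedy_inv t c -> pending c v != set0 ->
  t.+1 + #|pending c v| * tc <= D v.
Proof.
move=> inv /pending_max[u [pu gu leJ]].
have := undelivered_early (inv u); rewrite /delivered pu => /(_ gu).
have := deadline pu; have : #|pending c v| * tc <= J u * tc by rewrite leq_mul2r leJ orbT.
lia.
Qed.

Lemma greedy_inv_init : greedy_inv 0 (init G).
Proof.
move=> v; apply: Waiting => //=; first by rewrite /delivered; case: (par v).
case: (eqVneq (pending (init G) v) set0) => [->|]; first by rewrite cards0.
move=> /pending_max[u [pu _ leJ]]; have := deadline pu.
have : #|pending (init G) v| * tc <= J u * tc by rewrite leq_mul2r leJ orbT.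
lia.
Qed.

Lemma ready_of_pending c v :
  [forall u, (par u == Some v) ==> got c v u] = (pending c v == set0).
Proof.
apply/forallP/eqP => [h|h u].
  by apply/setP => u; rewrite !inE; have := h u; case: eqP => //= _ ->.
by apply/implyP => pu; have /setP/(_ u) := h; rewrite !inE pu /= => /negbFE.
Qed.

Lemma finish_send t c u v : node_inv t c u -> finish c u = Send v -> u \in pending c v.
Proof.
rewrite inE /finish /finished /greedy_action /busy.
case=> [d tu lu pu|d tu lu _|d cu tu lu _|p d pu cu tu lu _ _].
- by rewrite lu tu.
- rewrite lu /=; case: (1 < tok c u) => /=; first by case: ifP.
  case: (_ && _) => //=; case pu: (par u) => [p|] //=.
  by case: ifP => // _ [<-]; rewrite eqxx; move: d; rewrite /delivered pu.
- by rewrite lu /= cu; case: ifP.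
- rewrite lu /= cu; case: ifP => // _ [<-]; rewrite pu eqxx.
  by move: d; rewrite /delivered pu.
Qed.

(** A child delivers once, and only to its parent, so the arrivals of a round are exactly the
    children that stop being pending. The number of computations still owed, tokens plus pending
    children, is thus unaffected by arrivals. *)
Lemma pending_step t c v : greedy_inv t c ->
  #|pending c v| = #|pending (next c) v| + #|[set u | sends_to (finish c u) v]|.
Proof.
move=> inv; rewrite -(cardsID [set u | sends_to (finish c u) v] (pending c v)) addnC.
congr (_ + _); apply: eq_card => u; rewrite !inE; last first.
  rewrite andb_idl // => /sends_toP /(finish_send (inv u)).
  by rewrite inE.
by rewrite got_step negb_or /finish; case: (par u == _) => //=; rewrite andbC.
Qed.

Lemma pending_step0 t c v : greedy_inv t c -> pending c v = set0 ->
  pending (next c) v = set0 /\ #|[set u | sends_to (finish c u) v]| = 0.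
Proof.
move=> inv p0; have := pending_step v inv; rewrite p0 cards0 => h.
by split; last lia; apply/eqP; rewrite -cards_eq0; apply/eqP; lia.
Qed.

Lemma delivered_step c v : delivered (next c) v =
  delivered c v || (if par v is Some p then sends_to (finish c v) p else false).
Proof. by rewrite /delivered; case: (par v). Qed.

(** Deadlines strictly increase towards the root, which stands in for acyclicity of [par]. An
    undelivered non-root node of largest deadline would be pending at its parent; but the parent is
    the root or has delivered, and in both cases has no pending child. *)
Lemma root_done_total t c : greedy_inv t c ->
  tok c r = 1 -> pending c r = set0 -> total c = 1.
Proof.
move=> inv tr pr.
have dlv u p : par u = Some p -> delivered c u.
  pose P x := (par x != None) && ~~ delivered c x.
  move=> pu; apply: contraT => du.
  have Pu : P u by rewrite /P pu du.
  case: (arg_maxnP D Pu) => x /andP[]; case px: (par x) => [q|] // _ dx max.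
  have p0 : pending c q = set0.
    case: (eqVneq q r) => [->//|qr].
    have dq : delivered c q.
      apply: contraT => dq.
      have : P q by rewrite /P dq andbT; apply: contra qr => /eqP/par_root->.
      by move=> /max; have := deadline px; lia.
    by case: (inv q); rewrite ?dq.
  have := in_set0 x; rewrite -p0 inE px eqxx /=.
  by move: dx; rewrite /delivered px => ->.
rewrite /total (bigD1 r) //= tr big1 // => v vr.
have dv : delivered c v.
  case pv: (par v) => [p|]; first exact: dlv pv.
  by move/par_root: pv vr => ->; rewrite eqxx.
by case: (inv v); rewrite ?dv.
Qed.

(** Each completed computation lowers the work owed by one, paying for its [tc] rounds. A waiting
    node idles only if it has one token and pending children, where [slack_of_pending] restores the
    bound, or if it is the finished root, which the hypothesis on [total] excludes. *)
Lemma node_inv_step t c v : greedy_inv t c -> total c != 1 ->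
  node_inv t.+1 (next c) v.
Proof.
move=> inv tot.
have ps := pending_step v inv.
have ds := delivered_step c v.
have ts : tok (next c) v = tok c v - ~~ is_idle (finish c v)
          + #|[set u | sends_to (finish c u) v]| by [].
have ls : left (next c) v = _ := left_step _ _ c (greedy_action par c) v.
have cs : cur (next c) v = _ := cur_step _ _ c (greedy_action par c) v.
have fs : finish c v = _ := erefl (finished tc tm c (greedy_action par c) v).
rewrite /finished in fs.
have ps0 := @pending_step0 t c v inv.
(* The new configuration is now known only through the recorded equations, which keeps [/=] from
   unfolding [step]. *)
move: (next c) (finish c v) #|[set u | _]| ps ps0 ds ts ls cs fs.
move=> c' x k ps ps0 ds ts ls cs fs.
case: (inv v) => [d tv lv pv|d tv lv bnd|d cv tv lv bnd|p d pv cv tv lv pe bnd].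
- have [p0 a0] := ps0 pv.
  have gi : greedy_action par c v = Idle by rewrite /greedy_action /busy lv tv.
  apply: Delivered => //; first by rewrite ds d.
    by rewrite ts a0 tv.
  by rewrite ls gi /= lv.
- have [t2|t1] := ltnP 1 (tok c v).
    have gi : greedy_action par c v = Compute by rewrite /greedy_action /busy lv t2.
    rewrite gi /= in ls cs fs.
    have nd : ~~ delivered c' v.
      by rewrite ds negb_or d fs; case: (par v) => // p; case: ifP.
    (* An operation of duration 1 ends in the round in which it starts, so the node skips the busy
       state. *)
    case: (eqVneq tc 1) fs ts ls => [tc1|tc1] fs; rewrite fs /= => ts ls.
      apply: Waiting => //; [by lia| by lia|].
      have -> : (tok c' v).-1 + #|pending c' v|
         = ((tok c v).-1 + #|pending c v|).-1 by lia.
      by move: bnd; rewrite tc1; lia.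
    apply: Computing => //; [by lia| by lia|].
    have e : (tok c v).-1 + #|pending c v|
       = ((tok c' v).-2 + #|pending c' v|).+1 by lia.
    by move: bnd; rewrite e mulSn; lia.
  have {t1}{}tv : tok c v = 1 by lia.
  have [p0|pn0] := eqVneq (pending c v) set0.
    have [p0' a0] := ps0 p0.
    case pv: (par v) => [p|]; last first.
      move/par_root: pv => vr; case/eqP: tot.
      by apply: (root_done_total inv); rewrite -vr.
    have gi : greedy_action par c v = Send p.
      by rewrite /greedy_action /busy lv tv ready_of_pending p0 !eqxx pv.
    rewrite gi /= in ls cs fs.
    case: (eqVneq tm 1) fs => [tm1|tm1] fs.
      apply: Delivered => //; last by lia.
        by rewrite ds pv fs /= eqxx orbT.
      by rewrite ts fs a0 tv.
    apply: (@Sending _ _ _ p) => //.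
    - by rewrite ds pv fs (negbTE d).
    - by rewrite ts fs a0 tv.
    - by lia.
    - by move: bnd; rewrite p0 cards0 tv; lia.
  have gi : greedy_action par c v = Idle.
    by rewrite /greedy_action /busy lv tv ready_of_pending (negbTE pn0).
  rewrite gi /= lv /= in ls cs fs.
  apply: Waiting => //.
  - by rewrite ds negb_or d fs; case: (par v).
  - by rewrite ts fs tv.
  (* The old bound is useless here, since a round passes without work; the latest pending child
     supplies a new one. *)
  have := slack_of_pending inv pn0.
  have -> // : (tok c' v).-1 + #|pending c' v| = #|pending c v|.
  by rewrite fs /= in ts; lia.
- have gi : greedy_action par c v = Idle by rewrite /greedy_action /busy lv.
  rewrite gi /= cv in ls cs fs.
  have nd : ~~ delivered c' v.
    by rewrite ds negb_or d fs; case: (par v) => // p; case: ifP.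
  case: (eqVneq (left c v) 1) fs ts => [l1|l1] fs; rewrite fs /= => ts.
    apply: Waiting => //; [by lia|by lia|].
    have -> : (tok c' v).-1 + #|pending c' v|
         = (tok c v).-2 + #|pending c v| by lia.
    by lia.
  apply: Computing => //; [by lia|by lia|].
  have -> : (tok c' v).-2 + #|pending c' v|
         = (tok c v).-2 + #|pending c v| by lia.
  by lia.
- have gi : greedy_action par c v = Idle by rewrite /greedy_action /busy lv.
  rewrite gi /= cv in ls cs fs.
  have [p0' a0] := ps0 pe.
  case: (eqVneq (left c v) 1) fs => [l1|l1] fs.
    apply: Delivered => //; last by lia.
      by rewrite ds pv fs /= eqxx orbT.
    by rewrite ts fs a0 tv.
  apply: (@Sending _ _ _ p) => //.
  - by rewrite ds pv fs (negbTE d).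
  - by rewrite ts fs a0 tv.
  - by lia.
  - by lia.
Qed.

Lemma greedy_legal c : legal c (greedy_action par c).
Proof.
apply/forallP => v; rewrite /greedy_action.
case: (boolP (busy c v)) => nb //; case: (ltnP 1 (tok c v)) => // _.
case: ifP => // /andP[/eqP tv _]; case pv: (par v) => [p|] //.
by rewrite tv /= par_edge.
Qed.

(** At time [D r] the bound leaves no room for busy rounds or owed computations: the root has one
    token and no pending child. *)
Lemma root_inv t c : greedy_inv t c -> t <= D r /\ (t = D r -> total c = 1).
Proof.
have pr : par r = None by apply/par_root.
move=> inv; case: (inv r).
- by rewrite /delivered pr.
- move=> _ tr lr le; split=> [|tD]; first exact: leq_trans (leq_addr _ _) le.
  have /eqP : ((tok c r).-1 + #|pending c r|) * tc = 0.
    by move: le; rewrite tD; move: (_ * tc); lia.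
  rewrite muln_eq0 addn_eq0 [tc == 0]eqn0Ngt tc0 orbF => /andP[t0 p0].
  by apply: (root_done_total inv); [lia|apply/eqP; rewrite -cards_eq0].
- by move=> _ _ _ lr; move: (_ * tc) => y le; split; lia.
- by move=> p; rewrite pr.
Qed.

Lemma greedy_from_inv fuel t c : greedy_inv t c -> D r <= t + fuel ->
  let S := greedy_from tc tm par fuel c in
  [/\ legal_schedule tc tm c S, total (run tc tm c S) = 1 & size S <= D r - t].
Proof.
elim: fuel t c => [|k IH] t c inv le /=.
  (* Without fuel, [t] has reached [D r]. *)
  by have [tD tot] := root_inv inv; rewrite tot //; lia.
case: eqP => [tot|/eqP tot] //=.
have [tD totD] := root_inv inv.
have [|] := IH t.+1 (next c) (fun v => node_inv_step v inv tot); first by lia.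
rewrite greedy_legal => -> tot' sz; split => //.
have tD' : t != D r by apply: contra tot => /eqP /totD ->.
by apply: leq_ltn_trans sz _; lia.
Qed.

Lemma greedy_aggregation_solves : D r <= #|G| * (tc + tm) ->
  solves tc tm (greedy_aggregation tc tm par)
  /\ size (greedy_aggregation tc tm par) <= D r.
Proof.
move=> le; have [] := greedy_from_inv greedy_inv_init le.
by rewrite subn0.
Qed.

End Greedy.

(** * The lower bound *)

Section TreeSize.
Variables (tc tm : nat).
Hypothesis tc0 : 0 < tc.

Definition treeN R := tree_size (treeT tc tm R).

Lemma treeN_gt0 R : 0 < treeN R.
Proof. exact: tree_size_gt0. Qed.

Lemma treeN_small R : R < tm + tc -> treeN R = 1.
Proof. by move=> lt; rewrite /treeN treeT_rec // lt. Qed.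

Lemma treeN_add X : tm <= X -> treeN (X + tc) = treeN X + treeN (X - tm).
Proof.
move=> le; rewrite {1}/treeN treeT_rec // ltn_add2r ltnNge le /=.
by rewrite tree_size_join addnK.
Qed.

Lemma treeN_mono R R' : R <= R' -> treeN R <= treeN R'.
Proof.
elim/ltn_ind: R' R => R' IH R le.
have [lt|ge] := ltnP R (tm + tc); first by rewrite treeN_small // treeN_gt0.
have split Y : tm + tc <= Y -> treeN Y = treeN (Y - tc) + treeN (Y - tc - tm).
  by move=> geY; rewrite -treeN_add ?subnK //; lia.
rewrite (split R) // (split R'); last by lia.
by apply: leq_add; apply: IH; lia.
Qed.

End TreeSize.

Lemma subseq_rconsP (T : eqType) (s l : seq T) (x : T) : subseq s (rcons l x) ->
  subseq s l \/ exists2 s', s = rcons s' x & subseq s' l.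
Proof.
case/subseqP => m; rewrite size_rcons; case/lastP: m => // m b.
rewrite size_rcons => -[sm]; rewrite mask_rcons // => ->.
case: b => /=; [right; exists (mask m l); rewrite ?cats1|left; rewrite cats0];
  by rewrite ?mask_subseq.
Qed.

Section LowerBound.
Variables (G : graph) (tc tm : nat).
Hypotheses (tc0 : 0 < tc) (tm0 : 0 < tm).
Let N := treeN tc tm.

Let N_mono R R' : R <= R' -> N R <= N R' := @treeN_mono tc tm tc0 R R'.

(** Operations act on the front of the list while arrivals are appended at the back, so the operands
    of an operation in progress stay in place until it ends. *)
Definition merge_op (x : action G) (s : seq nat) :=
  match x with
  | Idle => s
  | Compute => if s is a :: b :: l then a + b :: l else s
  | Send _ => behead s
  end.

(* Each token carries the number of initial tokens it was made from.  A set of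
   [j] tokens of one node could be merged there within [(j - 1) * tc] more
   rounds, so its weight must not exceed the size of the tree for that time. *)
Definition weight_ok t s :=
  forall s', subseq s' s -> sumn s' <= N (t + (size s').-1 * tc).

(** The operands are already committed. A computation yields its token at time [t + l], after which
    each further token costs [tc]; a token arriving at [t + l] left [tm] rounds earlier and has not
    grown since. *)
Definition op_ok t (x : action G) l s :=
  match x with
  | Idle => True
  | Compute => exists a b s0, s = a :: b :: s0 /\
      forall s', subseq s' s0 -> a + b + sumn s' <= N (t + l + size s' * tc)
  | Send _ => exists a s0, [/\ s = a :: s0, tm <= t + l & a <= N (t + l - tm)]
  end.

Definition weights_inv t (c : config G) (w : G -> seq nat) :=
  forall v, [/\ size (w v) = tok c v, weight_ok t (w v)
    & 0 < left c v -> op_ok t (cur c v) (left c v) (w v)].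

(** This is the recursion N(X + tc) = N(X) + N(X - tm): merging one arrival into the rest costs
    [tc], and the arrival weighs at most what could be gathered [tm] rounds ago. *)
Lemma N_arrival t X x k : tm <= t -> t <= X -> x <= N (t - tm) -> k <= N X ->
  k + x <= N (X + tc).
Proof.
move=> le leX lex lek; rewrite /N treeN_add //; last by lia.
apply: leq_add => //; apply: leq_trans lex _; apply: N_mono; lia.
Qed.

Lemma weight_ok_rcons t s x : tm <= t -> x <= N (t - tm) ->
  weight_ok t s -> weight_ok t (rcons s x).
Proof.
move=> le lex ok s' /subseq_rconsP[/ok //|[s0 -> /ok ok0]].
rewrite size_rcons -cats1 sumn_cat /= addn0.
(* The arrival taken alone requires no merge; with other tokens it requires exactly one more. *)
case: s0 ok0 => [|y s0] ok0 /=.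
  by rewrite mul0n addn0; apply: leq_trans lex _; apply: N_mono; lia.
have := N_arrival (X := t + size s0 * tc) le _ lex ok0.
rewrite leq_addr => /(_ isT).
by rewrite /= mulSn [tc + _]addnC !addnA.
Qed.

Lemma op_ok_rcons t a l s x : tm <= t -> x <= N (t - tm) ->
  op_ok t a l s -> op_ok t a l (rcons s x).
Proof.
move=> le lex; case: a => [|[a [b [s0 [-> ok]]]]|v [a [s0 [-> le1 le2]]]] //=.
  exists a, b, (rcons s0 x); split=> // s' /subseq_rconsP[/ok //|[s1 -> /ok ok1]].
  rewrite size_rcons -cats1 sumn_cat /= addn0 addnA mulSn [tc + _]addnC addnA.
  by apply: (N_arrival le _ lex ok1); rewrite -addnA leq_addr.
by exists a, (rcons s0 x).
Qed.

Lemma weight_ok_cat t a l s xs : (forall x, x \in xs -> tm <= t /\ x <= N (t - tm)) ->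
  weight_ok t s /\ (0 < l -> op_ok t a l s) ->
  weight_ok t (s ++ xs) /\ (0 < l -> op_ok t a l (s ++ xs)).
Proof.
elim: xs s => [|x xs IH] s hx; first by rewrite cats0.
have [le lex] := hx x (mem_head _ _).
case=> ok1 ok2; rewrite -cat_rcons; apply: IH.
  by move=> y yin; apply: hx; rewrite inE yin orbT.
by split=> [|l0]; [exact: weight_ok_rcons|apply: op_ok_rcons => //; exact: ok2].
Qed.

Definition merge_step c a (w : G -> seq nat) v :=
  merge_op (finished tc tm c a v) (w v)
  ++ [seq head 0 (w u) | u <- enum [set u | sends_to (finished tc tm c a u) v]].

Let left' (c : config G) (a : G -> action G) v :=
  if is_idle (a v) then left c v else duration tc tm (a v).
Let cur' (c : config G) (a : G -> action G) v := if is_idle (a v) then cur c v else a v.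

(** For a computation just started, its two operands with [s'] are [size s' + 2] tokens, and the
    first of the [size s' + 1] merges accounts for its [tc] rounds. For a send, the singleton bound
    at time [t] is the bound [tm] rounds before arrival. *)
Lemma op_ok_start t c a w v : legal c a -> weights_inv t c w ->
  0 < left' c a v -> op_ok t (cur' c a v) (left' c a v) (w v).
Proof.
move=> /forallP/(_ v) lg /(_ v)[sz ok op]; rewrite /left' /cur'.
case: (a v) lg => [||u] //= /andP[_ lg] _.
  case: (w v) sz ok => [|x [|y s]] /= sz ok; [lia|lia|].
  exists x, y, s; split=> // s' ss.
  have := ok (x :: y :: s'); rewrite /= !eqxx ss => /(_ isT).
  by rewrite mulSn !addnA.
case: (w v) sz ok => [|x s] /= sz ok; first by case/andP: lg; lia.
exists x, s; split=> //; first exact: leq_addl.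
by have := ok [:: x]; rewrite /= eqxx sub0seq addnK !addn0 => ->.
Qed.

Lemma weight_ok_weaken t t' s s' : t <= t' -> subseq s' s -> weight_ok t s ->
  weight_ok t' s'.
Proof.
move=> le ss ok z /subseq_trans /(_ ss) /ok h; apply: leq_trans h _.
by apply: N_mono; lia.
Qed.

Lemma finishedE c a v :
  finished tc tm c a v = if left' c a v == 1 then cur' c a v else Idle.
Proof. by []. Qed.

Lemma weights_inv_step t c a w : legal c a -> weights_inv t c w ->
  weights_inv t.+1 (step tc tm c a) (merge_step c a w).
Proof.
move=> lg inv.
(* A send that ends now has one round left, so [op_ok] bounds its token by the weight possible [tm]
   rounds before. *)
have arr u v : sends_to (finished tc tm c a u) v ->
  tm <= t.+1 /\ head 0 (w u) <= N (t.+1 - tm).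
  rewrite finishedE; case: eqP => // l1; have := op_ok_start (v := u) lg inv.
  rewrite l1 => /(_ isT); case: (cur' c a u) => //= x [b [s0 [-> le1 le2]]] _.
  by rewrite -addn1.
move=> v; have [sz ok op] := inv v.
have opv := op_ok_start (v := v) lg inv.
(* First the effect of the node's own operation; the arrivals are added afterwards by
   [weight_ok_cat]. *)
have key : [/\ size (merge_op (finished tc tm c a v) (w v)) =
               tok c v - ~~ is_idle (finished tc tm c a v),
    weight_ok t.+1 (merge_op (finished tc tm c a v) (w v))
  & 0 < (left' c a v).-1 -> op_ok t.+1 (cur' c a v) (left' c a v).-1
      (merge_op (finished tc tm c a v) (w v))].
  rewrite finishedE; case: (eqVneq (left' c a v) 1) opv => [->|l1] opv /=.
    move/(_ isT): opv; case: (cur' c a v) => [||u] /=.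
    - move=> _; split; rewrite ?subn0 //.
      exact: weight_ok_weaken (leqnSn t) (subseq_refl _) ok.
    - case=> x [y [s0 [ws h]]]; rewrite -sz ws /= subSS subn0; split=> // s'.
      have ss : subseq s0 (x :: y :: s0).
        by apply: subseq_trans (subseq_cons _ _); apply: subseq_cons.
      have h' s1 : subseq s1 s0 -> sumn s1 <= N (t.+1 + (size s1).-1 * tc).
        by move: s1; apply: weight_ok_weaken (leqnSn t) ss _; rewrite -ws.
      (* A subsequence that uses the merged token is bounded by [op_ok], any other by the bound
         before the merge. *)
      case: s' => [|z s'] //=; case: eqP => [-> /h|_ /h' //].
      by rewrite addn1.
    - case=> x [s0 [ws _ _]]; rewrite -sz ws /= subSS subn0; split=> //.
      apply: weight_ok_weaken (leqnSn t) (subseq_cons s0 x) _.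
      by rewrite -ws.
  split; rewrite ?subn0 //.
    exact: weight_ok_weaken (leqnSn t) (subseq_refl _) ok.
  move=> l2; have {opv} := opv (leq_trans l2 (leq_pred _)).
  (* [op_ok] depends on [t] and [l] only through the completion time, which a round does not
     change. *)
  have e : t.+1 + (left' c a v).-1 = t + left' c a v by lia.
  by case: (cur' c a v) => [||u] //=; rewrite e.
case: key => sz1 ok1 op1.
split; first by rewrite size_cat size_map -cardE sz1.
  by case: (@weight_ok_cat t.+1 (cur' c a v) (left' c a v).-1 _
    [seq head 0 (w u) | u <- enum [set u | sends_to (finished tc tm c a u) v]]
    _ (conj ok1 op1)) => // x /mapP[u]; rewrite mem_enum inE => /arr h ->.
have [|_ h] := @weight_ok_cat t.+1 (cur' c a v) (left' c a v).-1 _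
    [seq head 0 (w u) | u <- enum [set u | sends_to (finished tc tm c a u) v]]
    _ (conj ok1 op1); last exact: h.
by move=> x /mapP[u]; rewrite mem_enum inE => /arr h ->.
Qed.

(** A merge keeps the weight, and the head that a sender drops reappears at exactly one receiver;
    exchanging the two sums makes this local to each sender. *)
Lemma merge_step_sum c a w : \sum_v sumn (merge_step c a w v) = \sum_v sumn (w v).
Proof.
under eq_bigr => v _ do rewrite sumn_cat.
rewrite big_split /=.
under [X in _ + X]eq_bigr => v _ do rewrite sumnE big_map big_enum /=.
have -> : \sum_v \sum_(u in [set u | sends_to (finished tc tm c a u) v]) head 0 (w u)
  = \sum_u \sum_(v | sends_to (finished tc tm c a u) v) head 0 (w u).
  rewrite (exchange_big_dep predT) //=.
  by apply: eq_bigr => u _; apply: eq_bigl => v; rewrite inE.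
rewrite -big_split /=; apply: eq_bigr => u _.
case: (finished tc tm c a u) => [||v] /=.
- by rewrite big_pred0 // addn0.
- by rewrite big_pred0 // addn0; case: (w u) => [|x [|y s]] //=; rewrite addnA.
- rewrite (big_pred1 v) => [|i]; last by rewrite /= eq_sym.
  by case: (w u) => //= x s; rewrite addnC.
Qed.

Lemma weights_run t c S w : legal_schedule tc tm c S -> weights_inv t c w ->
  exists w', weights_inv (t + size S) (run tc tm c S) w' /\
             \sum_v sumn (w' v) = \sum_v sumn (w v).
Proof.
elim: S t c w => [|a S IH] t c w /=; first by move=> _ inv; exists w; rewrite addn0.
case/andP => lg lS inv.
have [w' [inv' sw]] := IH _ _ _ lS (weights_inv_step lg inv).
by exists w'; rewrite addnS -addSn sw merge_step_sum.
Qed.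

Lemma solves_lower_bound (S : schedule G) : solves tc tm S -> #|G| <= N (size S).
Proof.
case=> lg tot; have inv0 : weights_inv 0 (init G) (fun _ => [:: 1]).
  move=> v; split=> // s' ss; apply: leq_trans (treeN_gt0 _ _ _).
  by case: s' ss => [|x [|y s']] //=; case: (x =P 1) => // ->.
have [w [inv sw]] := weights_run lg inv0.
rewrite add0n in inv; rewrite /= sum1_card in sw; rewrite -sw.
(* At most one token is left at each node, so multiplying by [tok] makes it unnecessary to locate
   the last one. *)
have le v : sumn (w v) <= tok (run tc tm (init G) S) v * N (size S).
  have [sz ok _] := inv v.
  have : tok (run tc tm (init G) S) v <= 1.
    by rewrite -tot /total (bigD1 v) //= leq_addr.
  rewrite -sz => sz1; have := ok _ (subseq_refl _).
  by case: (w v) sz1 => [|x [|y s]] //= _; rewrite mul0n mul1n !addn0.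
have /leq_trans : \sum_v sumn (w v) <= \sum_v tok (run tc tm (init G) S) v * N (size S).
  exact: leq_sum.
apply; by rewrite -big_distrl /=; move: tot; rewrite /total => ->; rewrite mul1n.
Qed.

End LowerBound.

(** * Optimality on the embedded tree *)

Section TreeNodes.
Variables (tc tm : nat).
Hypothesis tc0 : 0 < tc.

(** The number of times the recursion of T subtracts [tc] before falling below [tm + tc]; each time
    the root gains a child. *)
Definition arity R := (R - tm) %/ tc.

(** Makes the truncated subtractions in the budget of a child exact. *)
Lemma arity_bound R i : i < arity R -> (arity R - i) * tc + tm <= R.
Proof.
move=> lt; have := leq_divM (R - tm) tc; rewrite -/(arity R).
have : arity R - i <= arity R by lia.
rewrite -(leq_pmul2r tc0) => le1 le2.
suff : tm < R by lia.
by rewrite ltnNge; apply/negP; rewrite -subn_eq0 => /eqP R0; move: lt; rewrite /arity R0 div0n.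
Qed.

(** [join] appends, so the outermost step of the recursion creates the last child, and child [i] is
    created at step [arity R - i]. *)
Lemma treeT_children R : exists ts, [/\ treeT tc tm R = Node ts, size ts = arity R
  & forall i, i < arity R -> nth leaf ts i = treeT tc tm (R - (arity R - i) * tc - tm)].
Proof.
elim/ltn_ind: R => R IH; rewrite treeT_rec //; case: ltnP => [lt|ge].
  by exists [::]; rewrite /arity divn_small //; lia.
have eA : arity R = (arity (R - tc)).+1.
  have e : R - tm = tc + (R - tc - tm) by lia.
  by rewrite /arity e divnDl ?dvdnn // divnn tc0.
have [|ts [-> sz nt]] := IH (R - tc); first by lia.
rewrite eA; exists (rcons ts (treeT tc tm (R - tc - tm))); split=> //.
  by rewrite size_rcons sz.
move=> i; rewrite ltnS nth_rcons sz leq_eqVlt => /orP[/eqP->|lt].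
  by rewrite ltnn eqxx subSn // subnn mul1n.
by rewrite lt nt // subSn ?(ltnW lt) // mulSn subnDA.
Qed.

(* The [R'] such that the subtree of [T(R)] at the node [p] is [T(R')]. *)
Fixpoint budget R (p : seq nat) :=
  if p is i :: q then budget (R - (arity R - i) * tc - tm) q else R.

Lemma is_node_cons R i q : is_node (treeT tc tm R) (i :: q) =
  (i < arity R) && is_node (treeT tc tm (R - (arity R - i) * tc - tm)) q.
Proof.
have [ts [/= -> -> nt]] := treeT_children R.
by case: ltnP => // lt; rewrite nt.
Qed.

Lemma budget_rcons R p i : budget R (rcons p i) =
  budget R p - (arity (budget R p) - i) * tc - tm.
Proof. by elim: p R => [|j p IH] R //=; rewrite IH. Qed.

Lemma is_node_rcons R p i : is_node (treeT tc tm R) (rcons p i) =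
  is_node (treeT tc tm R) p && (i < arity (budget R p)).
Proof.
elim: p R => [|j p IH] R; first by rewrite is_node_cons /= andbT.
by rewrite rcons_cons !is_node_cons IH andbA.
Qed.

End TreeNodes.

Section EmbeddedParent.
Variables (n : nat) (f : 'I_n -> seq nat).
Hypothesis f_inj : injective f.
Hypothesis f_closed : forall v p i, f v = rcons p i -> exists u, f u = p.

Lemma embedded_parentP u v :
  embedded_parent f v = Some u <-> f v = rcons (f u) (last 0 (f v)).
Proof.
rewrite /embedded_parent; case: pickP => [x /eqP ex|no]; split.
- by case=> <-.
- move=> e; congr Some; apply: f_inj.
  by move: e; rewrite {1}ex => /rcons_inj[].
- by [].
- by move/eqP; rewrite no.
Qed.

Lemma embedded_parent_rcons u v i : f v = rcons (f u) i -> embedded_parent f v = Some u.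
Proof. by move=> e; apply/embedded_parentP; rewrite e last_rcons. Qed.

Lemma embedded_parent_None v : embedded_parent f v = None <-> f v = [::].
Proof.
split=> [|e]; last first.
  case pv: (embedded_parent f v) => [u|] //.
  by move/embedded_parentP: pv; rewrite e; case: (f u).
case/lastP e: (f v) => [//|p i]; have [u eu] := f_closed e.
by rewrite (@embedded_parent_rcons u v i) // eu.
Qed.

Lemma embedded_root : 0 < n -> exists r, f r = [::].
Proof.
move=> n0; move: (Ordinal n0) => v.
elim: {v}(size (f v)) {-2}v (erefl (size (f v))) => [|k IH] v.
  by move/size0nil; exists v.
case/lastP e: (f v) => [|p i] //; have [u eu] := f_closed e.
by rewrite size_rcons -eu => -[]; apply: IH.
Qed.

End EmbeddedParent.

Lemma Rstar_le tc tm n : 0 < tc -> Rstar tc tm n <= n * (tc + tm).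
Proof.
move=> tc0; case: (RstarP tm n tc0) => _; apply.
exact: ltnW (treeT_size_ge tm n tc0).
Qed.

Lemma opt_complete_optimal (n tc tm : nat) (f : 'I_n -> seq nat) :
  0 < n -> 0 < tc -> 0 < tm -> embedding (Tstar tc tm n) f ->
  optimally_solves tc tm (opt_complete tc tm f).
Proof.
move=> n0 tc0 tm0 [inj nodes closed].
have [r fr] := embedded_root closed n0.
(* With the budget as deadline and the rank from the last sibling as [J], the hypothesis [deadline]
   holds with equality. *)
pose D (v : complete_graph n) := budget tc tm (Rstar tc tm n) (f v).
pose J (v : complete_graph n) :=
  if embedded_parent f v is Some p then arity tc tm (D p) - last 0 (f v) else 0.
have Jlt (u v : complete_graph n) : embedded_parent f u = Some v ->
    last 0 (f u) < arity tc tm (D v).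
  move=> /(embedded_parentP inj) e; have := nodes u.
  by rewrite e is_node_rcons // => /andP[_]; rewrite last_rcons.
have Dr : D r = Rstar tc tm n by rewrite /D fr.
have [||||||sol le] := @greedy_aggregation_solves (complete_graph n) tc tm
    (embedded_parent f) D J r tc0 tm0.
- move=> u v /(embedded_parentP inj) e; apply/eqP => uv.
  by have := congr1 size e; rewrite uv size_rcons; lia.
- by move=> v; rewrite (embedded_parent_None inj closed) -fr; split=> [/inj|->].
- by move=> u v pu; rewrite /J pu subn_gt0; exact: Jlt.
- move=> u u' v pu pu'; have := Jlt _ _ pu; have := Jlt _ _ pu'; rewrite /J pu pu'.
  move=> l l' e; have el : last 0 (f u) = last 0 (f u') by lia.
  move/(embedded_parentP inj): pu; move/(embedded_parentP inj): pu'.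
  by rewrite el => <- /inj.
- move=> u v pu; rewrite /J pu; have := arity_bound tc0 (Jlt _ _ pu).
  have e := (embedded_parentP inj v u).1 pu.
  by rewrite /D e budget_rcons last_rcons -/(D v); lia.
- by rewrite Dr card_ord; exact: Rstar_le.
(* Any solution has [n <= |T(size S')|], so minimality of R* bounds its length from below. *)
split=> // S' /(solves_lower_bound tc0 tm0); rewrite card_ord => leN.
by apply: leq_trans le _; rewrite Dr; apply: (RstarP tm n tc0).2.
Qed.

(** * Execution triples with polynomial cost *)

(* Cost of a command all of whose loops make at most [L] iterations. *)
Fixpoint cbound (L : nat) (c : com) : nat :=
  match c with
  | Put _ i e => (ecost i + ecost e).+1
  | Emit e => (ecost e).+1
  | Seq c1 c2 => (cbound L c1 + cbound L c2).+1
  | If e c1 c2 => (ecost e + (cbound L c1 + cbound L c2)).+1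
  | While e c => L * (ecost e + cbound L c).+1 + (ecost e).+1
  end.

(** Each loop raises the degree by one. Degrees of subcommands are added instead of maximized, and
    [0 < L] absorbs constants into powers. *)
Lemma cbound_poly c : exists C d, forall L, 0 < L -> cbound L c <= C * L ^ d.
Proof.
have mono C L d d' : 0 < L -> d <= d' -> C * L ^ d <= C * L ^ d'.
  by move=> L0 le; rewrite leq_mul2l leq_pexp2l ?orbT.
elim: c => [x i e|e|c1 [C1 [d1 h1]] c2 [C2 [d2 h2]]
           |e c1 [C1 [d1 h1]] c2 [C2 [d2 h2]]|e c [C [d h]]] /=.
- by exists (ecost i + ecost e).+1, 0 => L _; rewrite muln1.
- by exists (ecost e).+1, 0 => L _; rewrite muln1.
- exists (C1 + C2).+1, (d1 + d2) => L L0.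
  have l1 := mono C1 _ _ _ L0 (leq_addr d2 d1).
  have l2 := mono C2 _ _ _ L0 (leq_addl d1 d2).
  have p0 : 0 < L ^ (d1 + d2) by rewrite expn_gt0 L0.
  have := h1 L L0; have := h2 L L0; rewrite mulSn mulnDl; lia.
- exists (ecost e + C1 + C2).+1, (d1 + d2) => L L0.
  have l1 := mono C1 _ _ _ L0 (leq_addr d2 d1).
  have l2 := mono C2 _ _ _ L0 (leq_addl d1 d2).
  have p0 : 0 < L ^ (d1 + d2) by rewrite expn_gt0 L0.
  have l3 : ecost e <= ecost e * L ^ (d1 + d2) by rewrite leq_pmulr.
  have := h1 L L0; have := h2 L L0; rewrite mulSn !mulnDl; lia.
- exists (C + (ecost e).+1 + (ecost e).+1), d.+1 => L L0.
  have p0 : 0 < L ^ d by rewrite expn_gt0 L0.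
  have l1 : (ecost e).+1 <= (ecost e).+1 * L ^ d.+1.
    by rewrite leq_pmulr // expn_gt0 L0.
  have l2 : (ecost e).+1 <= (ecost e).+1 * L ^ d by rewrite leq_pmulr.
  have l3 : L * (ecost e + cbound L c).+1 <= L * ((C + (ecost e).+1) * L ^ d).
    by rewrite leq_mul2l; apply/orP; right; have := h L L0; rewrite mulnDl; lia.
  rewrite mulnDl; apply: leq_add => //.
  by rewrite expnS mulnCA.
Qed.

(** Total correctness from a given memory. The cost bound depends on the command alone, so the rules
    only have to bound loop iterations. *)
Definition triple L c m o (Q : memory -> seq nat -> Prop) :=
  exists t m' o', [/\ exec c m o t m' o', t <= cbound L c & Q m' o'].

Arguments update m x i k y j /.

Section Rules.
Variable L : nat.
Implicit Types (Q : memory -> seq nat -> Prop) (m : memory) (o : seq nat).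

Lemma triple_weaken c m o Q Q' : triple L c m o Q ->
  (forall m' o', Q m' o' -> Q' m' o') -> triple L c m o Q'.
Proof. by move=> [t [m' [o' [h1 h2 h3]]]] h; exists t, m', o'; split; auto. Qed.

Lemma triple_put x i e m o Q :
  Q (update m x (eval m i) (eval m e)) o -> triple L (Put x i e) m o Q.
Proof.
by move=> h; exists (ecost i + ecost e).+1; do 2!eexists; split; [exact: ExecPut| |].
Qed.

Lemma triple_emit e m o Q : Q m (rcons o (eval m e)) -> triple L (Emit e) m o Q.
Proof.
by move=> h; exists (ecost e).+1; do 2!eexists; split; [exact: ExecEmit| |].
Qed.

Lemma triple_seq c1 c2 m o Q :
  triple L c1 m o (fun m1 o1 => triple L c2 m1 o1 Q) -> triple L (Seq c1 c2) m o Q.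
Proof.
move=> [t1 [m1 [o1 [h1 l1 [t2 [m2 [o2 [h2 l2 q]]]]]]]].
exists (t1 + t2).+1, m2, o2; split=> //; first exact: ExecSeq h1 h2.
by rewrite /= ltnS leq_add.
Qed.

Lemma triple_if e c1 c2 m o Q :
  (eval m e != 0 -> triple L c1 m o Q) -> (eval m e = 0 -> triple L c2 m o Q) ->
  triple L (If e c1 c2) m o Q.
Proof.
move=> h1 h2; have [e0|e0] := eqVneq (eval m e) 0.
  have [t [m' [o' [h l q]]]] := h2 e0; exists (ecost e + t).+1, m', o'.
  by split=> //=; [exact: ExecIfFalse|lia].
have [t [m' [o' [h l q]]]] := h1 e0; exists (ecost e + t).+1, m', o'.
by split=> //=; [exact: ExecIfTrue|lia].
Qed.

(* [k] bounds the number of remaining iterations. *)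
Lemma triple_while e c (I : nat -> memory -> seq nat -> Prop) Q k m o :
  k <= L -> I k m o ->
  (forall k m o, I k m o -> eval m e = 0 -> Q m o) ->
  (forall k m o, I k m o -> eval m e != 0 ->
     0 < k /\ triple L c m o (I k.-1)) ->
  triple L (While e c) m o Q.
Proof.
move=> kL Ik hQ hI.
suff [t [m' [o' [h l q]]]] : exists t m' o', [/\ exec (While e c) m o t m' o',
    t <= k * (ecost e + cbound L c).+1 + (ecost e).+1 & Q m' o'].
  exists t, m', o'; split=> //; apply: leq_trans l _.
  by rewrite /= leq_add2r leq_mul2r kL orbT.
elim: k m o {kL} Ik => [|k IH] m o Ik.
  have [e0|e0] := eqVneq (eval m e) 0; last by case: (hI _ _ _ Ik e0).
  by exists (ecost e).+1, m, o; split; [exact: ExecWhileFalse| |exact: hQ Ik e0].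
have [e0|e0] := eqVneq (eval m e) 0.
  exists (ecost e).+1, m, o; split; [exact: ExecWhileFalse| |exact: hQ Ik e0].
  exact: leq_addl.
have [_ [t1 [m1 [o1 [h1 l1 I1]]]]] := hI _ _ _ Ik e0.
have [t2 [m2 [o2 [h2 l2 q]]]] := IH _ _ I1.
exists (ecost e + t1 + t2).+1, m2, o2; split=> //; first exact: ExecWhileTrue h1 h2.
by rewrite mulSn; lia.
Qed.

Definition Skip := While (Lit 0) (Emit (Lit 0)).

Lemma triple_skip m o Q : Q m o -> triple L Skip m o Q.
Proof.
move=> q; exists 2, m, o; split=> //; first exact: ExecWhileFalse.
by rewrite /= addn2.
Qed.

Definition Var x := Get x (Lit 0).
Definition SetVar x e := Put x (Lit 0) e.

Definition For x lim body :=
  Seq (SetVar x (Lit 0))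
      (While (Sub lim (Var x)) (Seq body (SetVar x (Add (Var x) (Lit 1))))).

(** The invariant must be insensitive to the counter cell, which the loop itself overwrites, and
    must fix the value of the limit; the body must leave the counter alone. *)
Lemma triple_for x lim body (I : nat -> memory -> seq nat -> Prop) K m o :
  K <= L -> I 0 m o ->
  (forall i m o k, I i m o -> I i (update m x 0 k) o) ->
  (forall i m o, I i m o -> eval m lim = K) ->
  (forall i m o, i < K -> m x 0 = i -> I i m o ->
     triple L body m o (fun m' o' => m' x 0 = i /\ I i.+1 m' o')) ->
  triple L (For x lim body) m o (I K).
Proof.
move=> KL I0 Iupd Ilim Ibody; apply/triple_seq/triple_put => /=.
apply: (@triple_while _ _
  (fun k m o => exists i, [/\ i + k = K, m x 0 = i & I i m o]) _ K) => //.
- by exists 0; split; [|rewrite /update !eqxx|exact: Iupd].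
- move=> k m1 o1 [i [ik mi Ii]] /=; rewrite (Ilim _ _ _ Ii) mi => e0.
  by have -> : K = i by lia.
- move=> k m1 o1 [i [ik mi Ii]] /=; rewrite (Ilim _ _ _ Ii) mi => e0.
  split; first by lia.
  apply/triple_seq/(triple_weaken (Ibody _ _ _ _ mi Ii)); first by lia.
  move=> m2 o2 [mi2 Ii2]; apply/triple_put => /=.
  exists i.+1; split; [by lia|by rewrite /update !eqxx mi2 addn1|exact: Iupd].
Qed.

Lemma triple_for_ord x lim body (I : nat -> memory -> seq nat -> Prop) n m o :
  n <= L -> I 0 m o ->
  (forall i m o k, I i m o -> I i (update m x 0 k) o) ->
  (forall i m o, I i m o -> eval m lim = n) ->
  (forall (v : 'I_n) m o, m x 0 = v -> I v m o ->
     triple L body m o (fun m' o' => m' x 0 = v /\ I v.+1 m' o')) ->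
  triple L (For x lim body) m o (I n).
Proof.
move=> nL I0 Iupd Ilim Ibody; apply: triple_for => // i m1 o1 ltn.
exact: (Ibody (Ordinal ltn)).
Qed.

End Rules.

(** [xs] lists the arrays that may have been written. *)
Definition same (xs : seq nat) (m m' : memory) :=
  forall x i, x \notin xs -> m x i = m' x i.

Lemma same_update xs m m' x i k : x \in xs -> same xs m m' ->
  same xs (update m x i k) m'.
Proof.
move=> xin sm y j yn; rewrite /update; case: (y =P x) => [e|_] /=; last exact: sm.
by move: yn; rewrite e xin.
Qed.

Lemma same_trans xs ys m1 m2 m3 : {subset xs <= ys} -> same xs m1 m2 -> same ys m2 m3 ->
  same ys m1 m3.
Proof.
move=> sub s12 s23 x i nx; rewrite s12 ?s23 //.
by apply: contra nx => /sub.
Qed.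

(** * Growing the tree *)

Notation xN := 0 (only parsing).
Notation xTC := 1 (only parsing).
Notation xTM := 2 (only parsing).
Notation xPAR := 3 (only parsing).
Notation xNXT := 4 (only parsing).
Notation xCNT := 5 (only parsing).
Notation xBEST := 6 (only parsing).
Notation xI := 7 (only parsing).

Section Grow.
Variables (n tc tm R : nat).
Hypotheses (tc0 : 0 < tc) (R_large : n <= treeN tc tm R).
Let N := treeN tc tm.
Let bud := budget tc tm R.

(* The first [k] nodes, [F v] being the path of node [v] in [T(R)] and [P v] its
   parent.  Node [v] has so far received the [nr v - 1] children with the
   largest budgets, and [X v = R - b] for the budget [b] of the next one.  In
   [grown_size], the summand of [v] counts [v] and its subtrees still missing. *)
Record grown k (P X : nat -> nat) (F : nat -> seq nat) (nr : nat -> nat) := Grown {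
  grown_root : F 0 = [::];
  grown_rootP : P 0 = n;
  grown_par : forall v, 0 < v < k -> P v < k /\ exists i, F v = rcons (F (P v)) i;
  grown_inj : forall u v, u < k -> v < k -> F u = F v -> u = v;
  grown_node : forall v, v < k -> is_node (treeT tc tm R) (F v);
  grown_nr : forall v, v < k -> 0 < nr v;
  grown_next : forall v, v < k -> X v + bud (F v) = R + nr v * tc + tm;
  grown_used : forall u v i, u < k -> v < k -> F u = rcons (F v) i ->
    arity tc tm (bud (F v)) < i + nr v;
  grown_size : N R = \sum_(v < k) N (R + tc + tm - X v) }.

Lemma grown_init P X : P 0 = n -> X 0 = tc + tm ->
  grown 1 P X (fun _ => [::]) (fun _ => 1).
Proof.
move=> P0 X0; split=> //.
- by case=> [|v].
- by move=> [|u] [|v].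
- by move=> [|v] //= _; rewrite X0 /bud /=; lia.
- by rewrite big_ord1 /= X0 -addnA addnK.
Qed.

(** The smallest [X] marks the largest available budget. The next child of [b] has budget [R - X b],
    and its own first child would lie [tc + tm] below that. *)
Lemma grown_spawn k P X F nr b P' X' : grown k P X F nr -> k < n -> b < k ->
  (forall v, v < k -> X b <= X v) ->
  (forall v, P' v = if v == k then b else P v) ->
  (forall v, X' v = if v == b then X b + tc
                    else if v == k then X b + (tc + tm) else X v) ->
  exists F' nr', grown k.+1 P' X' F' nr'.
Proof.
move=> [root rootP par inj node nr0 next used size] kn bk min P'E X'E.
(* Otherwise no node has a child left, every summand of [grown_size] is 1, and T(R) has only [k < n]
   nodes. *)
have XbR : X b <= R.
  rewrite leqNgt; apply/negP => lt.
  have : N R = k.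
    rewrite size (eq_bigr (fun => 1)) ?sum1_card ?card_ord // => v _.
    by rewrite /N treeN_small //; have := min v (ltn_ord v); lia.
  by move: R_large; rewrite -/(N R); lia.
pose A := arity tc tm (bud (F b)).
have nxb := next b bk.
have nrA : nr b <= A by rewrite /A /arity leq_divRL //; lia.
(* Children are handed out from the last index downwards, since budgets decrease towards index 0. *)
pose i := A - nr b.
have iA : i < A by have := nr0 b bk; rewrite /i; lia.
pose F' v := if v == k then rcons (F b) i else F v.
pose nr' v := if v == k then 1 else if v == b then (nr b).+1 else nr v.
have budk : bud (rcons (F b) i) = R - X b.
  rewrite /bud budget_rcons -/(bud (F b)) -/A; have -> : A - i = nr b by rewrite /i; lia.
  by lia.
have F'old v : v < k -> F' v = F v by move=> lt; rewrite /F' ltn_eqF.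
have F'k : F' k = rcons (F b) i by rewrite /F' eqxx.
have fresh v : v < k -> F v != rcons (F b) i.
  move=> vk; apply/eqP => /(used v b i vk bk); rewrite -/A /i; lia.
have split v : v < k.+1 -> v < k \/ v = k by lia.
(* The new node is a leaf: a child of it among the old nodes would have its parent path among them,
   against [fresh]. *)
have closed u j : u < k -> F u != rcons (rcons (F b) i) j.
  move=> uk; apply/eqP => e; have [u0|u0] := posnP u.
    by move: e; rewrite u0 root; case: (rcons _ i).
  have [|Pu [l]] := par u; first by rewrite u0.
  by rewrite e => /rcons_inj[e' _]; case/eqP: (fresh _ Pu).
exists F', nr'; split.
- by rewrite F'old // (leq_ltn_trans _ bk).
- by rewrite P'E; case: eqP => // e; move: bk; rewrite -e.
- move=> v /andP[v0 /split[vk|->]]; rewrite P'E.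
    rewrite ltn_eqF // F'old //; have [|Pv [j e]] := par v; first by rewrite v0.
    by rewrite F'old //; split; [lia|exists j].
  by rewrite eqxx F'k F'old //; split; [lia|exists i].
- move=> u v /split[uk|->] /split[vk|->] //; rewrite ?F'k ?F'old //.
  + exact: inj.
  + by move=> e; case/eqP: (fresh _ uk).
  + by move=> e; case/eqP: (fresh _ vk).
- move=> v /split[vk|->]; first by rewrite F'old // node.
  by rewrite F'k is_node_rcons // node.
- move=> v /split[vk|->]; rewrite /nr' ?eqxx // ltn_eqF //.
  by case: ifP => // _; exact: nr0.
- move=> v /split[vk|->]; rewrite X'E /nr'.
    rewrite F'old // (ltn_eqF vk); case: (v =P b) => [->|_]; last exact: next.
    by rewrite mulSn; lia.
  by rewrite eqxx gtn_eqF // F'k budk; lia.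
- move=> u v j /split[uk|->] /split[vk|->]; rewrite ?F'k ?F'old //.
  + move=> /(used u v j uk vk); rewrite /nr' (ltn_eqF vk); case: (v =P b) => [->|] //.
    by lia.
  + by move=> e; case/eqP: (closed u j uk).
  + rewrite /nr' (ltn_eqF vk) => /rcons_inj[/(inj b v bk vk) <- <-].
    by rewrite eqxx -/A /i; lia.
  + by move=> /(congr1 seq.size); rewrite !size_rcons; lia.
(* The recursion for N splits the old summand of [b] into the new summands of [b] and of [k]. *)
- rewrite size big_ord_recr /= (bigD1 (Ordinal bk)) //= [in RHS](bigD1 (Ordinal bk)) //=.
  rewrite !X'E eqxx gtn_eqF // eqxx.
  have -> : R + tc + tm - X b = R + tm - X b + tc by lia.
  have -> : R + tc + tm - (X b + tc) = R + tm - X b by lia.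
  have -> : R + tc + tm - (X b + (tc + tm)) = R + tm - X b - tm by lia.
  rewrite {1}/N treeN_add //; last by lia.
  rewrite -/N addnAC; congr (_ + _ + _); apply: eq_bigr => v vb.
  by rewrite X'E (ltn_eqF (ltn_ord v)); case: (_ =P b) => // e; case/eqP: vb; apply: val_inj.
Qed.

Definition grow_scan :=
  Seq (SetVar xBEST (Lit 0))
      (For xI (Var xCNT)
        (If (Sub (Get xNXT (Var xBEST)) (Get xNXT (Var xI)))
            (SetVar xBEST (Var xI)) Skip)).

Definition grow_spawn :=
  Seq (Put xPAR (Var xCNT) (Var xBEST))
  (Seq (Put xNXT (Var xCNT) (Add (Get xNXT (Var xBEST)) (Add (Var xTC) (Var xTM))))
  (Seq (Put xNXT (Var xBEST) (Add (Get xNXT (Var xBEST)) (Var xTC)))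
       (SetVar xCNT (Add (Var xCNT) (Lit 1))))).

(** R* is never computed: storing distances from it in [xNXT] makes the comparison of budgets
    independent of it. *)
Definition grow :=
  Seq (Put xPAR (Lit 0) (Var xN))
  (Seq (Put xNXT (Lit 0) (Add (Var xTC) (Var xTM)))
  (Seq (SetVar xCNT (Lit 1))
       (While (Sub (Var xN) (Var xCNT)) (Seq grow_scan grow_spawn)))).

Lemma grow_scanP L k m o : k <= L -> 0 < k -> m xCNT 0 = k ->
  triple L grow_scan m o (fun m' o' => [/\ o' = o, same [:: xBEST; xI] m' m,
    m' xBEST 0 < k & forall v, v < k -> m xNXT (m' xBEST 0) <= m xNXT v]).
Proof.
move=> kL k0 mk; apply/triple_seq/triple_put => /=.
set I := fun i m1 (o1 : seq nat) => [/\ o1 = o, same [:: xBEST; xI] m1 m,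
  m1 xBEST 0 < k & forall v, v < i -> m xNXT (m1 xBEST 0) <= m xNXT v].
apply: (@triple_for L _ _ _ I k) => //.
- by split=> //; apply: same_update.
- move=> i m1 o1 j [-> sm lt le]; split=> //; exact: same_update.
- by move=> i m1 o1 [_ sm _ _] /=; rewrite sm.
move=> i m1 o1 ik mi [-> sm lt le]; apply: triple_if => /=.
  rewrite mi !(sm 4) // => gt; apply/triple_put => /=; rewrite mi.
  split=> //; split=> //.
    exact: same_update.
  move=> v; rewrite ltnS leq_eqVlt /update /= => /orP[/eqP->//|/le]; lia.
rewrite mi !(sm 4) // => ge; apply/triple_skip.
split=> //; split=> // v; rewrite ltnS leq_eqVlt => /orP[/eqP->|/le //]; lia.
Qed.

Lemma growP L m o : n <= L -> 0 < n -> m xN 0 = n -> m xTC 0 = tc -> m xTM 0 = tm ->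
  triple L grow m o (fun m' o' => [/\ o' = o,
    same [:: xPAR; xNXT; xCNT; xBEST; xI] m' m
    & exists F nr, grown n (m' xPAR) (m' xNXT) F nr]).
Proof.
move=> nL n0 mn mtc mtm.
apply/triple_seq/triple_put/triple_seq/triple_put/triple_seq/triple_put => /=.
rewrite mn mtc mtm.
set I := fun j m1 o1 => exists k F nr, [/\ o1 = o,
   same [:: xPAR; xNXT; xCNT; xBEST; xI] m1 m, m1 xCNT 0 = k, 0 < k /\ k + j = n
   & grown k (m1 xPAR) (m1 xNXT) F nr].
apply: (@triple_while L _ _ I _ n.-1); first by lia.
- exists 1, (fun _ => [::]), (fun _ => 1); split=> //; last by apply: grown_init.
    by do 3!apply: same_update => //.
  by lia.
- move=> j m1 o1 [k [F [nr [-> sm mk [k0 kj] gr]]]] /=; rewrite sm // mn mk => e0.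
  have e : k = n by lia.
  by split=> //; exists F, nr; rewrite -e.
move=> j m1 o1 [k [F [nr [-> sm mk [k0 kj] gr]]]] /=; rewrite sm // mn mk => e0.
split; first by lia.
apply: triple_seq; apply: triple_weaken (grow_scanP (k := k) _ _ _ mk) _ => //.
  by lia.
move=> m2 o2 [-> sm2 bk min].
apply/triple_seq/triple_put/triple_seq/triple_put/triple_seq/triple_put/triple_put => /=.
have e5 : m2 xCNT 0 = k by rewrite sm2.
have e1 : m2 xTC 0 = tc by rewrite sm2 // sm.
have e2 : m2 xTM 0 = tm by rewrite sm2 // sm.
have e4 v : m2 xNXT v = m1 xNXT v by rewrite sm2.
have e3 v : m2 xPAR v = m1 xPAR v by rewrite sm2.
rewrite e5 e1 e2 !e4 (ltn_eqF bk); set mm := update _ _ _ _.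
have [||//|v|v|F' [nr' gr']] :=
    @grown_spawn k (m1 xPAR) (m1 xNXT) F nr (m2 xBEST 0) (mm xPAR) (mm xNXT) gr.
- by lia.
- by [].
- by rewrite /mm /= e3.
- by rewrite /mm /= e4.
exists k.+1, F', nr'; split=> //; last by lia.
- do 4!apply: same_update => //; apply: same_trans sm2 sm.
  by move=> x; rewrite !inE => /orP[] ->; rewrite !orbT.
- by rewrite /mm /= addn1.
Qed.

End Grow.

(** * Simulating greedy aggregation *)

Notation xTOK := 8 (only parsing).
Notation xCUR := 9 (only parsing).
Notation xLEFT := 10 (only parsing).
Notation xDONE := 11 (only parsing).
Notation xACT := 12 (only parsing).
Notation xFIN := 13 (only parsing).
Notation xNEW := 14 (only parsing).
Notation xTOT := 15 (only parsing).
Notation xV := 16 (only parsing).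
Notation xU := 17 (only parsing).
Notation xFLAG := 18 (only parsing).

(* Vertices are smaller than [n], which therefore encodes the absence of a parent. *)
Definition parent_code n (x : option 'I_n) : nat := if x is Some p then p : nat else n.

Lemma grown_embedding n tc tm R P X F nr : 0 < n -> 0 < tc ->
  grown n tc tm R n P X F nr ->
  let f (v : 'I_n) := F v in
  embedding (treeT tc tm R) f
  /\ forall v : 'I_n, P v = parent_code (embedded_parent f v).
Proof.
move=> n0 tc0 [root rootP par inj node _ _ _ _] f.
have f_inj : injective f by move=> u v /(inj _ _ (ltn_ord u) (ltn_ord v)) /val_inj.
have f_closed v p i : f v = rcons p i -> exists u, f u = p.
  rewrite /f; have [->|v0] := posnP v; first by rewrite root; case: p.
  have [|Pv [j ->]] := par v; first by rewrite v0 /=.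
  by case/rcons_inj=> <- _; exists (Ordinal Pv).
split; first by split=> // v; exact: node.
move=> v; have [v0|v0] := posnP v.
  by rewrite (embedded_parent_None f_inj f_closed v).2 /f v0 ?root.
have [|Pv [j e]] := par v; first by rewrite v0 /=.
by rewrite (embedded_parent_rcons f_inj (u := Ordinal Pv) (i := j) (v := v)).
Qed.

Lemma forall_ord_ltS n (P : pred 'I_n) (v : 'I_n) :
  [forall u : 'I_n, (u < v.+1) ==> P u] = [forall u : 'I_n, (u < v) ==> P u] && P v.
Proof.
apply/forallP/andP => [h|[/forallP h Pv] u].
  split; last by have := h v; rewrite leqnn.
  by apply/forallP => u; apply/implyP => lt; have := h u; rewrite ltnS ltnW.
rewrite ltnS leq_eqVlt; apply/implyP => /orP[/eqP/val_inj->//|lt].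
by have := h u; rewrite lt.
Qed.

Lemma card_ord_ltS n (P : pred 'I_n) (v : 'I_n) :
  #|[set u : 'I_n | (u < v.+1) && P u]| = #|[set u : 'I_n | (u < v) && P u]| + P v.
Proof.
rewrite -!sum1dep_card (bigID (fun u : 'I_n => u < v)) /=; congr (_ + _).
  by apply: eq_bigl => u; case: (ltnP u v) => lt; rewrite ?andbF // ltnS ltnW ?andbT.
rewrite (eq_bigl (fun u => (u == v) && P v)).
  by case: (P v); [under eq_bigl => u do rewrite andbT; rewrite big_pred1_eq|
                   rewrite big_pred0 // => u; rewrite andbF].
move=> u; case: eqP => [->|ne] /=; first by rewrite ltnn leqnn andbT.
apply/negbTE; apply/negP => /andP[/andP[h _]]; rewrite -leqNgt => h'.
by apply: ne; apply: val_inj; apply/eqP; rewrite eqn_leq -ltnS h h'.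
Qed.

Section Simulation.
Variables (n tc tm L : nat) (par : 'I_n -> option 'I_n).
Hypothesis nL : n <= L.
Let G := complete_graph n.
Let dlv := @delivered G par.
Let greedy := @greedy_action G par.
Implicit Types (c : config G) (a : G -> action G) (m : memory) (o : seq nat).

Definition static m :=
  [/\ m xN 0 = n, m xTC 0 = tc, m xTM 0 = tm
    & forall v : 'I_n, m xPAR v = parent_code (par v)].

(** One bit per node replaces the matrix [got], because the greedy rule only asks whether a child
    has delivered to its parent. The last clause guarantees that sends in progress go to the
    parent. *)
Definition encodes m c := static m /\ forall v : 'I_n,
  [/\ m xTOK v = tok c v, m xCUR v = action_code (cur c v), m xLEFT v = left c v,
      m xDONE v = dlv c v
    & forall p, cur c v = Send p -> par v = Some p].

Definition sim_ready :=
  Seq (SetVar xFLAG (Lit 0))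
      (For xU (Var xN)
        (If (Add (Sub (Get xPAR (Var xU)) (Var xV)) (Sub (Var xV) (Get xPAR (Var xU))))
            Skip
            (If (Get xDONE (Var xU)) Skip (SetVar xFLAG (Lit 1))))).

Lemma sim_readyP c m o (v : 'I_n) : static m -> m xV 0 = v ->
  (forall u : 'I_n, m xDONE u = dlv c u) ->
  triple L sim_ready m o (fun m' o' => [/\ o' = o, same [:: xU; xFLAG] m' m
    & (m' xFLAG 0 == 0) = [forall u, (par u == Some v) ==> got c v u]]).
Proof.
move=> [mN _ _ mP] mv mD; apply/triple_seq/triple_put => /=.
set I := fun i m1 o1 => [/\ o1 = o, same [:: xU; xFLAG] m1 m
  & (m1 xFLAG 0 == 0) =
    [forall u : 'I_n, (u < i) ==> ((par u == Some v) ==> got c v u)]].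
apply: (triple_weaken (Q := I n)); last first.
  move=> m1 o1 [-> sm ->]; split=> //; apply: eq_forallb => u.
  by rewrite ltn_ord.
apply: triple_for_ord => //.
- split=> //; first exact: same_update.
  by rewrite /= eqxx; apply/esym/forallP => u.
- by move=> i m1 o1 k [-> sm fl]; split=> //; exact: same_update.
- by move=> i m1 o1 [_ sm _] /=; rewrite sm.
move=> u m1 o1 mi [-> sm fl].
(* The two truncated differences both vanish only on equality, and the code [n] of a missing parent
   differs from every vertex. *)
have parE : ((parent_code (par u) - v + (v - parent_code (par u))) == 0) = (par u == Some v).
  rewrite addn_eq0 !subn_eq0 -eqn_leq; case: (par u) => [p|] /=.
    by apply/eqP/eqP => [/val_inj->|[->]].
  by rewrite gtn_eqF.
apply: triple_if => /=; rewrite mi !(sm 3) // (sm 16) // mv mP => e.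
  apply: triple_skip; split=> //; split=> //; rewrite fl forall_ord_ltS.
  by move: e; rewrite parE => /negbTE->; rewrite andbT.
move/eqP: e; rewrite parE => pu.
have dE : dlv c u = got c v u by rewrite /dlv /delivered (eqP pu).
apply: triple_if => /=; rewrite mi (sm 11) // mD dE => e.
  apply: triple_skip; split=> //; split=> //; rewrite fl forall_ord_ltS pu.
  by move: e; case: (got c v u); rewrite ?andbT.
apply: triple_put => /=; split=> //; split=> //; first exact: same_update.
rewrite /= forall_ord_ltS pu.
by move: e; case: (got c v u); rewrite ?andbF.
Qed.

Definition sim_action :=
  Seq (SetVar xACT (Lit 0))
  (If (Get xLEFT (Var xV)) Skip
  (If (Sub (Get xTOK (Var xV)) (Lit 1)) (SetVar xACT (Lit 1))
  (If (Get xTOK (Var xV))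
    (Seq sim_ready
      (If (Var xFLAG) Skip
      (If (Sub (Var xN) (Get xPAR (Var xV)))
          (SetVar xACT (Add (Get xPAR (Var xV)) (Lit 2))) Skip)))
    Skip))).

Lemma sim_actionP c m o (v : 'I_n) : static m -> m xV 0 = v ->
  (forall u : 'I_n, m xDONE u = dlv c u) ->
  m xTOK v = tok c v -> m xLEFT v = left c v ->
  triple L sim_action m o (fun m' o' => [/\ o' = o, same [:: xACT; xU; xFLAG] m' m
    & m' xACT 0 = action_code (greedy c v)]).
Proof.
move=> st mv mD mT mL; have [mN _ _ mP] := st.
rewrite /greedy /greedy_action /busy; apply/triple_seq/triple_put => /=.
apply: triple_if => /=; rewrite mv mL => l0.
  by apply: triple_skip; rewrite lt0n l0; split=> //; exact: same_update.
apply: triple_if => /=; rewrite mv mT l0 /= => t2.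
  have -> : 1 < tok c v by lia.
  by apply: triple_put; split=> //; do 2!apply: same_update => //.
have -> : (1 < tok c v) = false by lia.
apply: triple_if => /=; rewrite mv mT => t1; last first.
  by rewrite t1 /=; apply: triple_skip; split=> //; exact: same_update.
have -> : tok c v == 1 by lia.
apply/triple_seq; apply: triple_weaken (@sim_readyP c _ _ v _ _ _) _ => //.
move=> m1 o1 [-> sm fl].
have sm1 : same [:: xACT; xU; xFLAG] m1 m.
  apply: same_trans sm _; last exact: same_update.
  by move=> x; rewrite !inE => /orP[] ->; rewrite !orbT.
have a0 : m1 xACT 0 = 0 by rewrite sm.
apply: triple_if => /= fl1.
  by rewrite -fl (negbTE fl1) /=; apply: triple_skip.
rewrite -fl fl1 /=; apply: triple_if => /=.
  rewrite !sm1 // mv mP mN; case pv: (par v) => [p|] /= e; last by move: e; rewrite subnn.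
  apply: triple_put => /=; rewrite !sm1 // mv mP pv addn2; split=> //.
  exact: same_update.
rewrite !sm1 // mv mP mN; case pv: (par v) => [p|] /= e.
  by have := ltn_ord p; lia.
by apply: triple_skip.
Qed.

(** Arrays in [xs] may change anywhere, those in [ys] only at index [v]. *)
Definition frame (xs ys : seq nat) (v : nat) m m' := forall x i,
  x \notin xs -> (x \notin ys) || (i != v) -> m x i = m' x i.

Lemma frame_update xs ys v x i k m m' : (x \in xs) || (x \in ys) && (i == v) ->
  frame xs ys v m m' -> frame xs ys v (update m x i k) m'.
Proof.
move=> h fr y j yx yy; rewrite /=; case: andP => [[/eqP ey /eqP ej]|_]; last exact: fr.
by move: h yx yy; rewrite ey ej; do 2!case: (_ \in _) => //=; move=> ->.
Qed.

Let fin c v := finished tc tm c (greedy c) v.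
Let next c := step tc tm c (greedy c).

Definition sim_start :=
  Seq sim_action
  (Seq (Emit (Var xACT))
       (If (Var xACT)
         (Seq (Put xCUR (Var xV) (Var xACT))
              (If (Sub (Var xACT) (Lit 1))
                  (Put xLEFT (Var xV) (Var xTM)) (Put xLEFT (Var xV) (Var xTC))))
         Skip)).

Lemma sim_startP c m o (v : 'I_n) : static m -> m xV 0 = v ->
  (forall u : 'I_n, m xDONE u = dlv c u) ->
  m xTOK v = tok c v -> m xLEFT v = left c v -> m xCUR v = action_code (cur c v) ->
  triple L sim_start m o (fun m' o' =>
    [/\ o' = rcons o (action_code (greedy c v)),
        frame [:: xACT; xU; xFLAG] [:: xCUR; xLEFT] v m' m,
        m' xCUR v = action_code (if is_idle (greedy c v) then cur c v else greedy c v)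
      & m' xLEFT v =
        if is_idle (greedy c v) then left c v else duration tc tm (greedy c v)]).
Proof.
move=> st mv mD mT mL mC; apply: triple_seq.
apply: triple_weaken (sim_actionP _ st mv mD mT mL) _ => m1 o1 [-> sm act].
have fr : frame [:: xACT; xU; xFLAG] [:: xCUR; xLEFT] v m1 m.
  by move=> x i nx _; exact: sm.
have [_ mtc mtm _] := st.
apply/triple_seq/triple_emit; rewrite /= act.
apply: triple_if => /=; rewrite act => e.
  apply/triple_seq/triple_put; rewrite /= act; apply: triple_if => /=; rewrite act => e2.
    apply: triple_put; rewrite /= !(sm 2) // !(sm 16) // mv mtm.
    case: (greedy c v) e e2 => [||p] //= _ _; rewrite !eqxx; split=> //.
    by do 2!(apply: frame_update; first by rewrite eqxx).
  apply: triple_put; rewrite /= !(sm 1) // !(sm 16) // mv mtc.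
  case: (greedy c v) e e2 => [||p] //= _ _; rewrite !eqxx; split=> //.
  by do 2!(apply: frame_update; first by rewrite eqxx).
apply: triple_skip; case: (greedy c v) e => //= _.
by split=> //; rewrite sm.
Qed.

Definition sim_finish :=
  Seq (If (Add (Sub (Get xLEFT (Var xV)) (Lit 1)) (Sub (Lit 1) (Get xLEFT (Var xV))))
          (Put xFIN (Var xV) (Lit 0)) (Put xFIN (Var xV) (Get xCUR (Var xV))))
  (Seq (Put xLEFT (Var xV) (Sub (Get xLEFT (Var xV)) (Lit 1)))
       (If (Get xFIN (Var xV))
           (Put xNEW (Var xV) (Sub (Get xTOK (Var xV)) (Lit 1)))
           (Put xNEW (Var xV) (Get xTOK (Var xV))))).

Lemma sim_finishP (x : action 'I_n) l k m o (v : 'I_n) : m xV 0 = v ->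
  m xCUR v = action_code x -> m xLEFT v = l -> m xTOK v = k ->
  let y := if l == 1 then x else Idle in
  triple L sim_finish m o (fun m' o' => [/\ o' = o,
    frame [::] [:: xLEFT; xFIN; xNEW] v m' m, m' xLEFT v = l.-1,
    m' xFIN v = action_code y & m' xNEW v = k - ~~ is_idle y]).
Proof.
move=> mv mC mL mT y; apply: triple_seq.
have fr : frame [::] [:: xLEFT; xFIN; xNEW] v m m by [].
apply: (triple_weaken (Q := fun m' o' => [/\ o' = o,
    frame [::] [:: xLEFT; xFIN; xNEW] v m' m, m' xLEFT v = l & m' xFIN v = action_code y])).
  have -> : action_code y = if l == 1 then action_code x else 0 by rewrite /y; case: eqP.
  apply: triple_if => /=; rewrite mv mL => e; apply: triple_put; rewrite /= mv eqxx.
    split=> //; first by apply: frame_update; rewrite //= eqxx.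
    by case: (l =P 1) e => [->|].
  split=> //; first by apply: frame_update; rewrite //= eqxx.
  by rewrite mC; case: eqP => // ?; lia.
move=> m1 o1 [-> fr1 mL1 mF1].
have mv1 : m1 xV 0 = v by rewrite fr1.
have mT1 : m1 xTOK v = k by rewrite fr1.
apply/triple_seq/triple_put; rewrite /= mv1 mL1.
apply: triple_if => /=; rewrite mv1 mF1 => e; apply: triple_put; rewrite /= mv1 mT1 eqxx /=.
  split=> //; try by lia.
    by do 2!(apply: frame_update; first by rewrite eqxx).
  by case: (y) e.
split=> //; try by lia.
  by do 2!(apply: frame_update; first by rewrite eqxx).
by case: (y) e => //= _; rewrite subn0.
Qed.

Definition sim_node := Seq sim_start sim_finish.

Definition node_loop_inv c o i m o' :=
  [/\ static m, o' = o ++ [seq action_code (greedy c v) | v <- take i (enum 'I_n)]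
   & forall v : 'I_n,
   [/\ m xTOK v = tok c v, m xDONE v = dlv c v,
       m xCUR v = action_code (if v < i then cur (next c) v else cur c v),
       m xLEFT v = if v < i then left (next c) v else left c v
     & v < i -> m xFIN v = action_code (fin c v)
                /\ m xNEW v = tok c v - ~~ is_idle (fin c v)]].

Lemma sim_node_loopP c m o : encodes m c ->
  triple L (For xV (Var xN) sim_node) m o (node_loop_inv c o n).
Proof.
move=> [st enc]; apply: triple_for_ord => //.
- by split=> //; [rewrite take0 cats0|move=> v; have [] := enc v].
- by move=> i m1 o1 [[mN _ _ _] _ _]; exact: mN.
move=> v m1 o1 mv [st1 -> h]; have [mT mD mC mL _] := h v; rewrite ltnn in mC mL.
apply: triple_seq; apply: triple_weaken (sim_startP _ st1 mv _ mT mL mC) _.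
  by move=> u; have [] := h u.
move=> m2 o2 [-> fr mC2 mL2].
apply: triple_weaken (sim_finishP _ _ mC2 mL2 (erefl _)) _; first by rewrite fr.
rewrite fr // mT.
move=> m3 o3 [-> fr3 mL3 mF3 mN3].
have fr13 (x i : nat) : x \notin [:: xACT; xU; xFLAG] ->
    (x \notin [:: xCUR; xLEFT; xFIN; xNEW]) || (i != v :> nat) -> m3 x i = m1 x i.
  move=> nx hx; rewrite fr3 // ?fr //; move: hx; case: (i != v :> nat); rewrite ?orbT //.
    by rewrite !orbF !inE !negb_or => /and4P[-> ->].
  by rewrite !orbF !inE !negb_or => /and4P[_ -> -> ->].
split; first by rewrite fr13.
split.
- case: st1 => s0 s1 s2 s3.
  by split; [| | |move=> u]; rewrite fr13.
- rewrite (take_nth v) ?size_enum_ord // nth_ord_enum map_rcons rcons_cat.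
  by [].
move=> u; have [uT uD uC uL uF] := h u.
have [->|ne] := eqVneq u v.
  rewrite leqnn; split=> //; [by rewrite fr13|by rewrite fr13|].
  by rewrite fr3 // mC2.
have lt : (u < v.+1) = (u < v) by rewrite ltnS leq_eqVlt val_eqE (negbTE ne).
by rewrite lt !fr13 ?val_eqE ?ne ?orbT.
Qed.

Definition sim_deliver :=
  If (Sub (Get xFIN (Var xV)) (Lit 1))
     (Seq (Put xNEW (Sub (Get xFIN (Var xV)) (Lit 2))
                    (Add (Get xNEW (Sub (Get xFIN (Var xV)) (Lit 2))) (Lit 1)))
          (Put xDONE (Var xV) (Lit 1)))
     Skip.

Definition deliver_loop_inv c o i m o' :=
  [/\ static m, o' = o & forall v : 'I_n,
   [/\ m xCUR v = action_code (cur (next c) v), m xLEFT v = left (next c) v,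
       m xFIN v = action_code (fin c v),
       m xNEW v = tok c v - ~~ is_idle (fin c v)
                  + #|[set u : 'I_n | (u < i) && sends_to (fin c u) v]|
     & m xDONE v = if v < i then dlv (next c) v else dlv c v]].

(** Marking the sender agrees with [delivered] because every finished send goes to the parent. Codes
    above 1 are the sends. *)
Lemma sim_deliver_loopP c m o o0 : node_loop_inv c o0 n m o ->
  (forall v p, fin c v = Send p -> par v = Some p) ->
  triple L (For xV (Var xN) sim_deliver) m o (deliver_loop_inv c o n).
Proof.
move=> [st _ enc] finP; apply: triple_for_ord => //.
- split=> // v; have [mT mD mC mL mF] := enc v; rewrite ltn_ord in mC mL mF.
  have [mF1 mN1] := mF isT; split=> //.
  by rewrite mN1 (_ : [set u | _] = set0) ?cards0 ?addn0 //; apply/setP => u; rewrite !inE.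
- by move=> i m1 o1 [[mN _ _ _] _ _]; exact: mN.
move=> v m1 o1 mv [st1 -> h]; have [mC mL mF mN mD] := h v; rewrite ltnn in mD.
have ds : dlv (next c) v =
    dlv c v || (if par v is Some p then sends_to (fin c v) p else false).
  exact: delivered_step.
apply: triple_if => /=; rewrite mv mF => e.
  case fv: (fin c v) e => [||p] //= _.
  apply/triple_seq/triple_put/triple_put; rewrite /= mv mF fv /= subSS subSS subn0.
  split=> //; split=> //.
  move=> u; have [uC uL uF uN uD] := h u; split=> //=.
    rewrite card_ord_ltS addnA -uN fv /= eq_sym.
    by case: (p =P u) => [->|ne]; rewrite ?eqxx ?addn0 //; case: eqP => // /val_inj.
  have [->|ne] := eqVneq u v.
    by rewrite eqxx leqnn ds (finP _ _ fv) fv /= eqxx orbT.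
  have lt : (u < v.+1) = (u < v) by rewrite ltnS leq_eqVlt val_eqE (negbTE ne).
  by rewrite lt; case: eqP => // /val_inj /eqP; rewrite (negbTE ne).
apply: triple_skip; split=> //; split=> // u; have [uC uL uF uN uD] := h u; split=> //.
  by rewrite card_ord_ltS addnA -uN; case: (fin c v) e => //= _; rewrite addn0.
have [->|ne] := eqVneq u v.
  rewrite leqnn mD ds; case: (fin c v) e => //= _; case: (par v) => *; by rewrite ?orbF.
by rewrite ltnS leq_eqVlt val_eqE (negbTE ne).
Qed.

Definition sim_commit :=
  Seq (Put xTOK (Var xV) (Get xNEW (Var xV)))
      (SetVar xTOT (Add (Var xTOT) (Get xNEW (Var xV)))).

Definition commit_loop_inv c o i m o' :=
  [/\ static m, o' = o, m xTOT 0 = \sum_(v < n | v < i) tok (next c) v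
   & forall v : 'I_n,
   [/\ m xCUR v = action_code (cur (next c) v), m xLEFT v = left (next c) v,
       m xDONE v = dlv (next c) v, m xNEW v = tok (next c) v
     & v < i -> m xTOK v = tok (next c) v]].

Lemma sim_commit_loopP c m o : deliver_loop_inv c o n m o -> m xTOT 0 = 0 ->
  triple L (For xV (Var xN) sim_commit) m o (commit_loop_inv c o n).
Proof.
move=> [st _ enc] tot; apply: triple_for_ord => //.
- split=> //; first by rewrite tot big_pred0.
  move=> v; have [mC mL mF mN mD] := enc v; split=> //; last first.
    rewrite mN tok_step; congr (_ + _); apply: eq_card => u.
    by rewrite !inE ltn_ord.
  by rewrite mD ltn_ord.
- by move=> i m1 o1 [[mN _ _ _] _ _ _]; exact: mN.
move=> v m1 o1 mv [st1 -> tot1 h]; have [mC mL mD mN mT] := h v.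
apply/triple_seq/triple_put/triple_put; rewrite /= mv mN.
split=> //; split=> //.
  rewrite /= tot1 [in RHS](bigID (fun u : 'I_n => u < v)) /=; congr (_ + _).
    by apply: eq_bigl => u; case: (ltnP u v) => lt; rewrite ?andbF // ltnS ltnW.
  rewrite (big_pred1 v) // => u.
  by rewrite /= -leqNgt ltnS -eqn_leq val_eqE.
move=> u; have [uC uL uD uN uT] := h u; split=> //=.
rewrite val_eqE; have [->//|ne] := eqVneq u v.
by rewrite ltnS leq_eqVlt val_eqE (negbTE ne).
Qed.

(** Three passes keep the round synchronous: actions are chosen while [xTOK] and [xDONE] are still
    old, arrivals are collected in [xNEW], and only then are the token counts replaced. *)
Definition sim_round :=
  Seq (For xV (Var xN) sim_node)
  (Seq (For xV (Var xN) sim_deliver)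
  (Seq (SetVar xTOT (Lit 0)) (For xV (Var xN) sim_commit))).

Lemma cur_next_send c v p : (forall p, cur c v = Send p -> par v = Some p) ->
  cur (next c) v = Send p -> par v = Some p.
Proof.
move=> curP; rewrite /next cur_step; case: ifP => _; first exact: curP.
rewrite /greedy /greedy_action; case: ifP => // _; case: ifP => // _.
by case: ifP => // _; case: (par v) => [q [->]|].
Qed.

Lemma sim_roundP c m o : encodes m c ->
  triple L sim_round m o (fun m' o' => [/\ encodes m' (next c),
    m' xTOT 0 = total (next c)
    & o' = o ++ [seq action_code (greedy c v) | v <- enum 'I_n]]).
Proof.
move=> enc; have curP v : forall p, cur c v = Send p -> par v = Some p.
  by have [] := enc.2 v.
have finP v p : fin c v = Send p -> par v = Some p.
  rewrite /fin /finished -[X in if _ then X else _]/(cur (next c) v).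
  by case: (_ == 1) => //; exact: cur_next_send (curP v).
apply: triple_seq; apply: triple_weaken (sim_node_loopP _ enc) _ => m1 o1 inv1.
apply: triple_seq; apply: triple_weaken (sim_deliver_loopP inv1 finP) _.
move=> m2 o2 inv2; apply/triple_seq/triple_put => /=.
have o12 : o2 = o1 by case: inv2.
rewrite o12 in inv2 *.
apply: triple_weaken (sim_commit_loopP (c := c) _ _) _ => //.
move=> m3 o3 [st3 -> tot3 h3]; split.
- split=> // v; have [mC mL mD mN mT] := h3 v; split=> //; first exact: mT.
  by move=> p; exact: cur_next_send (curP v).
- by rewrite tot3; apply: eq_bigl => v; rewrite ltn_ord.
- by case: inv1 => _ -> _; rewrite take_oversize // size_enum_ord.
Qed.

Definition sim_loop :=
  While (Add (Sub (Var xTOT) (Lit 1)) (Sub (Lit 1) (Var xTOT))) sim_round.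

(** The program has no fuel and stops when one token is left. That the fueled schedule ends with one
    token shows that the fuel does not run out first, so the two agree and [k] bounds the
    iterations. *)
Lemma sim_loopP k c m o : k <= L -> encodes m c -> m xTOT 0 = total c ->
  let S := @greedy_from G tc tm par k c in
  total (run tc tm c S) = 1 ->
  triple L sim_loop m o (fun _ o' => o' = o ++ schedule_code S).
Proof.
move=> kL enc tot S tot1.
set I := fun k m1 o1 => exists c1, [/\ encodes m1 c1, m1 xTOT 0 = total c1,
  total (run tc tm c1 (@greedy_from G tc tm par k c1)) = 1
  & o ++ schedule_code S = o1 ++ schedule_code (@greedy_from G tc tm par k c1)].
apply: (triple_while (I := I) (k := k)) => //; first by exists c.
  move=> j m1 o1 [c1 [enc1 mt1 fin1 ->]] /=; rewrite mt1 => e.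
  have -> : @greedy_from G tc tm par j c1 = [::].
    by case: j {fin1} => //= j; case: eqP => // ?; lia.
  by rewrite cats0.
move=> j m1 o1 [c1 [enc1 mt1 fin1 oE]] /=; rewrite mt1 => e.
have ne1 : (total c1 == 1) = false by lia.
case: j fin1 oE => [|j] /=; first by lia.
rewrite ne1 => fin1 oE; split=> //.
apply: triple_weaken (sim_roundP _ enc1) _ => m2 o2 [enc2 mt2 ->].
by exists (next c1); split=> //; rewrite oE /schedule_code /= catA.
Qed.

Definition sim_init :=
  Seq (For xV (Var xN) (Put xTOK (Var xV) (Lit 1))) (SetVar xTOT (Var xN)).

Lemma sim_initP m o : static m ->
  (forall v : 'I_n, [/\ m xCUR v = 0, m xLEFT v = 0 & m xDONE v = 0]) ->
  triple L sim_init m o (fun m' o' =>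
    [/\ encodes m' (init G), m' xTOT 0 = total (init G) & o' = o]).
Proof.
move=> st z; apply: triple_seq.
set I := fun i m1 o1 => [/\ static m1, o1 = o & forall v : 'I_n,
  [/\ m1 xCUR v = 0, m1 xLEFT v = 0, m1 xDONE v = 0 & v < i -> m1 xTOK v = 1]].
apply: (triple_weaken (Q := I n)).
  apply: triple_for_ord => //.
  - by split=> // v; have [] := z v.
  - by move=> i m1 o1 [[mN _ _ _] _ _]; exact: mN.
  move=> v m1 o1 mv [st1 -> h]; apply: triple_put; split=> //; split=> // u.
  have [uC uL uD uT] := h u; split=> //=; rewrite mv val_eqE.
  have [->//|ne] := eqVneq u v.
  by rewrite ltnS leq_eqVlt val_eqE (negbTE ne).
move=> m1 o1 [st1 -> h]; apply: triple_put; split=> //=.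
  split=> // v; have [uC uL uD uT] := h v; split=> //=; first exact: uT.
  by rewrite uD /dlv /delivered; case: (par v).
by case: st1 => -> _ _ _; rewrite /total /= sum1_card card_ord.
Qed.

End Simulation.

(** * The whole program and its running time *)

Definition opt_complete_prog := Seq grow (Seq sim_init sim_loop).

Lemma opt_complete_progP n tc tm : 0 < n -> 0 < tc -> 0 < tm ->
  exists f : 'I_n -> seq nat, embedding (Tstar tc tm n) f /\
    triple (n * (tc + tm)) opt_complete_prog (input n tc tm) [::]
      (fun _ o => o = schedule_code (opt_complete tc tm f)).
Proof.
(* This [L] bounds the loops over vertices and, being the fuel of the greedy schedule, also the
   number of rounds. *)
move=> n0 tc0 tm0; set L := n * (tc + tm).
have nL : n <= L by rewrite leq_pmulr // addn_gt0 tc0.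
have [Rn _] := RstarP tm n tc0.
have [t1 [m1 [o1 [ex1 le1 [o1E sm [F [nr gr]]]]]]] :=
  growP (m := input n tc tm) tc0 Rn [::] nL n0 erefl erefl erefl.
have [emb parE] := grown_embedding n0 tc0 gr.
set f := (fun v : 'I_n => F v) in emb parE.
exists f; split=> //.
apply: triple_seq; exists t1, m1, o1; split=> //; rewrite o1E.
have st : static tc tm (embedded_parent f) m1 by split=> //; rewrite sm.
apply: triple_seq; apply: triple_weaken (sim_initP nL [::] st _) _ => //.
  by move=> v; split; rewrite sm // /input /=; case: (_ == 0).
move=> m2 o2 [enc tot ->].
(* Termination of the simulation comes from the correctness of the schedule it produces. *)
have [[_ sol] _] := opt_complete_optimal n0 tc0 tm0 emb.
have kL : #|complete_graph n| * (tc + tm) <= L by rewrite card_ord.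
apply: triple_weaken (sim_loopP nL [::] kL enc tot sol) _ => // m3 o3 ->.
Qed.

Theorem theorem1 :
  (forall (n tc tm : nat) (f : 'I_n -> seq nat),
      0 < n -> 0 < tc -> 0 < tm ->
      embedding (Tstar tc tm n) f ->
      optimally_solves tc tm (opt_complete tc tm f))
  /\
  (exists (prog : com) (d : nat),
     forall n tc tm : nat, 0 < n -> 0 < tc -> 0 < tm ->
     exists (f : 'I_n -> seq nat) (t : nat) (m : memory),
       [/\ embedding (Tstar tc tm n) f,
           exec prog (input n tc tm) [::] t m
                (schedule_code (opt_complete tc tm f))
         & t <= (n + tc + tm) ^ d]).
Proof.
split; first exact: opt_complete_optimal.
have [C [d bound]] := cbound_poly opt_complete_prog.
(* With s = n + tc + tm, which is at least 2, the cost C * L^d is at most s^C * (s^2)^d, by C <= 2^C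
   and L <= s^2. *)
exists opt_complete_prog, (C + 2 * d) => n tc tm n0 tc0 tm0.
have [f [emb [t [m [o [ex le oE]]]]]] := opt_complete_progP n0 tc0 tm0.
exists f, t, m; split=> //; first by rewrite -oE.
apply: leq_trans le _; apply: leq_trans (bound _ _) _.
  by rewrite muln_gt0 n0 addn_gt0 tc0.
have mono a b e : a <= b -> a ^ e <= b ^ e by case: e => // e; rewrite leq_exp2r.
rewrite expnD expnM; apply: leq_mul; last by apply: mono; nia.
by apply: leq_trans (ltnW (ltn_expl C (leqnn 2))) (mono _ _ _ _); lia.
Qed.
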